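(* Let $\Omega$ be a compact, convex, regular (smooth boundary) domain of the Euclidean plane. Then $\mathcal{S}(\partial\Omega)=w(\partial\Omega)=\min_{\theta\in S^1}w(\theta)$.
   Context: For a unit vector $\theta\in S^1\subset\mathbb{R}^2$, $w(\theta)$ is the width of $\Gamma=\partial\Omega$ in the direction $\theta$: the smallest distance between two parallel lines that are both orthogonal to $\theta$ and contain $\Gamma$ between them. $w(\Gamma)$ is by definition the minimum of $w(\theta)$ over $\theta\in S^1$. $\mathcal{S}(\Gamma)$ is the min-max width: a family $\{p_t,q_t\}\subset\Gamma$, $t\in[0,1]$, is a sweepout of $\Gamma$ if (i) $p_0=q_0$, $p_1=q_1$; (ii) $t\mapsto p_t$, $t\mapsto q_t$ are continuous; (iii) $p_t,q_t$ bound a closed arc $C_t\subset\Gamma$ with $t\mapsto C_t$ continuous (distance between arcs = length of symmetric difference), $C_0=\{p_0\}$, $C_1=\Gamma$. Then $\mathcal{S}(\Gamma)=\inf\max_{t\in[0,1]}|p_t-q_t|$, the infimum over all sweepouts of $\Gamma$ (with $|\cdot|$ the Euclidean norm). *)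

(* Defs.v *)
From HB Require Import structures.
From mathcomp Require Import all_boot all_order all_algebra.
From mathcomp Require Import all_classical all_reals all_analysis.

Set Implicit Arguments.
Unset Strict Implicit.
Unset Printing Implicit Defensive.

Import Order.TTheory GRing.Theory Num.Theory.
Import numFieldNormedType.Exports.

Local Open Scope classical_set_scope.
Local Open Scope ring_scope.

Section Plane.
Variable R : realType.
Local Notation plane := 'rV[R]_2.

Definition is_max (A : set R) (m : R) : Prop := A m /\ ubound A m.

Definition is_min (A : set R) (m : R) : Prop := A m /\ lbound A m.

Definition dotp (u v : plane) : R := \sum_i u 0 i * v 0 i.

(* The library norm `|u| on 'rV[R]_2 is the sup norm. It is only used through
   the topology, which is the Euclidean one; metric notions use enorm. *)
Definition enorm (u : plane) : R := Num.sqrt (dotp u u).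

Definition unit_circle : set plane := [set theta | enorm theta = 1].

Definition boundary (A : set plane) : set plane := closure A `\` interior A.

Definition smooth (g : R -> R) : Prop :=
  forall (n : nat) (x : R), derivable (derive1n n g) x 1.

(* Near each boundary point x, in suitable orthonormal coordinates centred at
   x, the set is the subgraph of a C^oo function. *)
Definition smooth_boundary (Omega : set plane) : Prop :=
  forall x, boundary Omega x ->
  exists (r : R) (u v : plane) (g : R -> R),
    [/\ 0 < r, [/\ enorm u = 1, enorm v = 1 & dotp u v = 0], smooth g &
        forall y : plane, enorm (y - x) < r ->
          (Omega y <-> dotp (y - x) v <= g (dotp (y - x) u))].

(* The lines orthogonal to the unit vector theta are the level sets of
   dotp ^~ theta, and those of levels a <= b are at distance b - a. *)
Definition width (Gamma : set plane) (theta : plane) : R :=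
  inf [set d : R | exists a b : R,
        [/\ a <= b, forall x, Gamma x -> a <= dotp x theta <= b
          & d = b - a]].

Definition min_width (Gamma : set plane) : R :=
  inf [set width Gamma theta | theta in unit_circle].

(* 0 is added so that the empty set has diameter 0 rather than -oo. *)
Definition diameter (A : set plane) : \bar R :=
  ereal_sup ([set 0%E] `|` [set (enorm (x - y))%:E | x in A & y in A]).

(* The length of an arbitrary subset of the plane is its one-dimensional
   Hausdorff measure. *)
Definition length_at_scale (d : R) (A : set plane) : \bar R :=
  ereal_inf [set (\sum_(0 <= k <oo) diameter (U k))%E |
    U in [set U : (set plane)^nat |
           A `<=` \bigcup_k U k /\ forall k, (diameter (U k) <= d%:E)%E]].

Definition length (A : set plane) : \bar R :=
  ereal_sup [set length_at_scale d A | d in [set d : R | 0 < d]].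

Definition jordan_parametrization (Gamma : set plane) (c : R -> plane) : Prop :=
  [/\ continuous c,
      forall s t : R, c s = c t <-> exists k : int, t = s + k%:~R
    & range c = Gamma].

(* b = a gives the degenerate arc [set p], and b = a + 1 the whole curve. Both
   orientations of c are allowed, so the endpoints are in effect unordered. *)
Definition closed_arc (Gamma : set plane) (p q : plane) (C : set plane) : Prop :=
  exists (c : R -> plane) (a b : R),
    [/\ jordan_parametrization Gamma c, a <= b <= a + 1, c a = p, c b = q
      & C = c @` [set` `[a, b]]].

(* The values of p, q and C outside [0, 1] are irrelevant. *)
Definition is_sweepout (Gamma : set plane)
    (p q : R -> plane) (C : R -> set plane) : Prop :=
  [/\ forall t : R, 0 <= t <= 1 -> Gamma (p t) /\ Gamma (q t),
      p 0 = q 0 /\ p 1 = q 1,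
      {within `[0, 1], continuous p} /\ {within `[0, 1], continuous q},
      (forall t : R, 0 <= t <= 1 -> closed_arc Gamma (p t) (q t) (C t)) /\
      (forall t : R, 0 <= t <= 1 ->
         length (C s `+` C t) @[s --> within `[0, 1] (nbhs t)] --> 0%E)
    & C 0 = [set p 0] /\ C 1 = Gamma].

Definition minmax_width (Gamma : set plane) : \bar R :=
  ereal_inf [set M%:E | M in [set M : R | exists p q C,
    is_sweepout Gamma p q C /\
    is_max [set enorm (p t - q t) | t in [set t : R | 0 <= t <= 1]] M]].

End Plane.

Arguments unit_circle R _ : clear implicits.

(* Main.v *)
Require Import Defs.
From HB Require Import structures.
From mathcomp Require Import all_boot all_order all_algebra.
From mathcomp Require Import all_classical all_reals all_analysis.
From mathcomp Require Import zify ring lra.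

(**
Lower bound. If a chord [p q] of the convex body is shorter than the minimal
width, separation yields an interior translate of the segment [p q], i.e. a
vector [v] with [p + v] and [q + v] interior. Pushing along [v] then moves one
of the two arcs with endpoints [p], [q] entirely into the interior. Along a
sweepout whose chords are all this short, "the swept arc can be pushed inside"
and "the complementary arc can be pushed inside" are both open conditions on
[t], they exclude each other (a linear functional that is nonnegative on the
two pushing vectors has a maximum on the boundary), the first one holds at
[t = 0] and fails at [t = 1]: this contradicts the connectedness of [[0, 1]].

Upper bound. Take a strip of minimal width. In the direction orthogonal to its
normal, the abscissa is monotone along the two boundary arcs from a rightmost
to a leftmost point. Moving the two endpoints simultaneously along these arcs
with (almost) equal abscissae keeps their distance at most (almost) the width
of the strip.
*)

Set Implicit Arguments.
Unset Strict Implicit.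
Unset Printing Implicit Defensive.

Import Order.TTheory GRing.Theory Num.Theory.
Import numFieldNormedType.Exports.

Local Open Scope classical_set_scope.
Local Open Scope ring_scope.

(** * Euclidean geometry of the plane *)

Section PlaneGeometry.
Variable R : realType.
Local Notation plane := 'rV[R]_2.
Implicit Types (u v x y z : plane) (A B : set plane).

(** The interior translate comes from the difference body [Omega - Omega]: on unit vectors its
    support function is the width, so a vector shorter than the minimal width cannot be separated
    from it. The delicate point of the lower bound is openness in [t]. Arcs vary continuously only
    in the length of their symmetric difference, and a set of small length may still reach far away.
    Connectedness excludes this: the endpoints of [C s] stay close to [C t], so an excursion of
    [C s] away from [C t] has to come back, and its length is bounded below. Moreover every
    [closed_arc] carries its own Jordan parametrization, so arcs at different times are compared as
    sets only. For the upper bound the boundary is parametrized radially around an interior point.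
    Subadditivity of the gauge does double duty: it makes the curve Lipschitz, which controls the
    length of swept arcs, and it makes the abscissa monotone on the two arcs. *)

Lemma dotpE u v : dotp u v = u 0 0 * v 0 0 + u 0 1 * v 0 1.
Proof.
rewrite /dotp big_ord_recl big_ord1; congr (_ + u 0 _ * v 0 _); exact/val_inj.
Qed.

Lemma plane_eq u v : u 0 0 = v 0 0 -> u 0 1 = v 0 1 -> u = v.
Proof.
move=> h0 h1; apply/rowP => i.
by have [->|->] : i = 0 \/ i = 1 by
  case: i => [[|[|//]]] p; [left|right]; exact/val_inj.
Qed.

Lemma dotpC u v : dotp u v = dotp v u.
Proof. by rewrite !dotpE; ring. Qed.

Lemma dotpDl u v w : dotp (u + v) w = dotp u w + dotp v w.
Proof. by rewrite !dotpE !mxE; ring. Qed.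

Lemma dotpBl u v w : dotp (u - v) w = dotp u w - dotp v w.
Proof. by rewrite !dotpE !mxE; ring. Qed.

Lemma dotpNl u w : dotp (- u) w = - dotp u w.
Proof. by rewrite !dotpE !mxE; ring. Qed.

Lemma dotpZl k u w : dotp (k *: u) w = k * dotp u w.
Proof. by rewrite !dotpE !mxE; ring. Qed.

Lemma dotpDr u v w : dotp w (u + v) = dotp w u + dotp w v.
Proof. by rewrite !dotpE !mxE; ring. Qed.

Lemma dotpBr u v w : dotp w (u - v) = dotp w u - dotp w v.
Proof. by rewrite !dotpE !mxE; ring. Qed.

Lemma dotpNr u w : dotp w (- u) = - dotp w u.
Proof. by rewrite !dotpE !mxE; ring. Qed.

Lemma dotpZr k u w : dotp w (k *: u) = k * dotp w u.
Proof. by rewrite !dotpE !mxE; ring. Qed.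

Lemma dotp_ge0 u : 0 <= dotp u u.
Proof. by rewrite dotpE -!expr2 addr_ge0// sqr_ge0. Qed.

Lemma dotp_eq0 u : dotp u u = 0 -> u = 0.
Proof.
rewrite dotpE -!expr2 => /eqP; rewrite paddr_eq0 ?sqr_ge0// !sqrf_eq0.
by case/andP => /eqP h0 /eqP h1; apply: plane_eq; rewrite mxE.
Qed.

Lemma enorm_ge0 u : 0 <= enorm u.
Proof. exact: sqrtr_ge0. Qed.

Lemma enorm_sqr u : enorm u ^+ 2 = dotp u u.
Proof. by rewrite sqr_sqrtr// dotp_ge0. Qed.

Lemma enorm0 : enorm (0 : plane) = 0.
Proof. by rewrite /enorm dotpE !mxE !mul0r addr0 sqrtr0. Qed.

Lemma enorm_eq0 u : enorm u = 0 -> u = 0.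
Proof. by move=> u0; apply: dotp_eq0; rewrite -enorm_sqr u0 expr0n. Qed.

Lemma enorm_gt0 u : u != 0 -> 0 < enorm u.
Proof.
by move=> u0; rewrite lt_def enorm_ge0 andbT; apply: contra u0 => /eqP/enorm_eq0/eqP.
Qed.

Lemma enormZ k u : enorm (k *: u) = `|k| * enorm u.
Proof. by rewrite /enorm dotpZl dotpZr mulrA -expr2 sqrtrM ?sqr_ge0// sqrtr_sqr. Qed.

Lemma enormN u : enorm (- u) = enorm u.
Proof. by rewrite /enorm dotpNl dotpNr opprK. Qed.

Lemma enormBC u v : enorm (u - v) = enorm (v - u).
Proof. by rewrite -enormN opprB. Qed.

Lemma normr_dotp u v : `|dotp u v| <= enorm u * enorm v.
Proof.
rewrite -(@ler_pXn2r _ 2)// ?nnegrE ?mulr_ge0 ?enorm_ge0//.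
rewrite real_normK ?num_real// exprMn !enorm_sqr !dotpE -subr_ge0.
(* Lagrange's identity. *)
rewrite (_ : _ - _ = (u 0 0 * v 0 1 - u 0 1 * v 0 0) ^+ 2) ?sqr_ge0//; ring.
Qed.

Lemma ler_dotp u v : dotp u v <= enorm u * enorm v.
Proof. exact: le_trans (ler_norm _) (normr_dotp _ _). Qed.

Lemma ler_enormD u v : enorm (u + v) <= enorm u + enorm v.
Proof.
rewrite -(@ler_pXn2r _ 2)// ?nnegrE ?addr_ge0 ?enorm_ge0//.
rewrite sqrrD !enorm_sqr dotpDl !dotpDr (dotpC v u).
have := ler_dotp u v; lra.
Qed.

Lemma ler_enorm_dist u v w : enorm (u - w) <= enorm (u - v) + enorm (v - w).
Proof. by apply: le_trans (ler_enormD _ _); rewrite addrA subrK. Qed.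

Lemma ler_dist_enorm u v : `|enorm u - enorm v| <= enorm (u - v).
Proof.
have := ler_enormD (u - v) v; have := ler_enormD (v - u) u.
rewrite !subrK (enormBC v u) ler_norml => h1 h2; apply/andP; split; lra.
Qed.

Lemma normr_coord_le_enorm u i : `|u 0 i| <= enorm u.
Proof.
rewrite -(@ler_pXn2r _ 2)// ?nnegrE ?enorm_ge0// real_normK ?num_real//.
rewrite enorm_sqr dotpE.
have [->|->] : i = 0 \/ i = 1 by
  case: i => [[|[|//]]] p; [left|right]; exact/val_inj.
- by have := sqr_ge0 (u 0 1); rewrite !expr2; lra.
- by have := sqr_ge0 (u 0 0); rewrite !expr2; lra.
Qed.

Lemma normr_le_enorm u : `|u| <= enorm u.
Proof.
rewrite [leLHS]mx_normrE; apply: bigmax_le; first exact: enorm_ge0.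
by move=> [i j] _ /=; rewrite (ord1 i) normr_coord_le_enorm.
Qed.

Lemma enorm_le_normr u : enorm u <= 2 * `|u|.
Proof.
have c i : `|u 0 i| <= `|u|.
  rewrite [leRHS]mx_normrE.
  exact: (le_bigmax _ (fun ij : 'I_1 * 'I_2 => `|u ij.1 ij.2|) (0, i)).
have n0 := normr_ge0 u.
rewrite -(@ler_pXn2r _ 2)// ?nnegrE ?mulr_ge0 ?enorm_ge0// enorm_sqr dotpE.
have h i : u 0 i * u 0 i <= `|u| * `|u|.
  by rewrite -expr2 -real_normK ?num_real// expr2 ler_pM.
by have := h 0; have := h 1; have := mulr_ge0 n0 n0; rewrite exprMn !expr2; lra.
Qed.

(** Bridge between the library topology, given by the sup norm, and the Euclidean norm; the two
    norms agree up to a factor 2. *)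
Lemma nbhs_enormP x A :
  nbhs x A <-> exists2 e : R, 0 < e & forall y, enorm (y - x) < e -> A y.
Proof.
split.
- case/nbhs_ballP => e /= e0 h; exists e => // y yx; apply: h.
  rewrite -ball_normE /= -normrN opprB.
  exact: le_lt_trans (normr_le_enorm _) yx.
- case=> e e0 h; apply/nbhs_ballP; exists (e / 2) => /=; first exact: divr_gt0.
  move=> y; rewrite -ball_normE /= -normrN opprB => yx; apply: h.
  by apply: le_lt_trans (enorm_le_normr _) _; rewrite mulrC -ltr_pdivlMr.
Qed.

Lemma dist_lipschitz_continuous (T V : normedModType R) (f : T -> V) (K : R) :
  (forall s t : T, `|f s - f t| <= K * `|s - t|) -> continuous f.
Proof.
move=> fK s; apply/cvgrPdist_lt => e e0; near=> t.
apply: le_lt_trans (fK _ _) _.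
apply: (@le_lt_trans _ _ ((`|K| + 1) * `|s - t|)).
  by rewrite ler_wpM2r//; have := ler_norm K; lra.
rewrite mulrC -ltr_pdivlMr; last by have := normr_ge0 K; lra.
near: t; apply: (@cvgr_dist_lt _ _ _ (nbhs s) _ id s) => //.
by rewrite divr_gt0//; have := normr_ge0 K; lra.
Unshelve. all: by end_near. Qed.

Lemma enorm_lipschitz_continuous (f : plane -> R) (K : R) :
  0 <= K -> (forall x y, `|f x - f y| <= K * enorm (x - y)) -> continuous f.
Proof.
move=> K0 fK; apply: (@dist_lipschitz_continuous _ _ _ (K * 2)) => x y.
by apply: le_trans (fK x y) _; rewrite -mulrA ler_wpM2l// enorm_le_normr.
Qed.

Lemma curve_lipschitz_continuous (c : R -> plane) (K : R) :
  (forall s t, enorm (c s - c t) <= K * `|s - t|) -> continuous c.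
Proof.
move=> cK; apply: (@dist_lipschitz_continuous R^o plane _ K) => s t.
exact: le_trans (normr_le_enorm _) (cK s t).
Qed.

Lemma continuous_dotpl v : continuous (fun x : plane => dotp x v).
Proof.
apply: (@enorm_lipschitz_continuous _ (enorm v)); first exact: enorm_ge0.
by move=> x y; rewrite -dotpBl mulrC normr_dotp.
Qed.

Lemma continuous_dotpBl u v : continuous (fun x : plane => dotp (x - u) v).
Proof.
apply: (@enorm_lipschitz_continuous _ (enorm v)); first exact: enorm_ge0.
move=> x y; rewrite !dotpBl opprB addrA subrK -dotpBl mulrC; exact: normr_dotp.
Qed.

Lemma continuous_enormB v : continuous (fun x : plane => enorm (x - v)).
Proof.
apply: (@enorm_lipschitz_continuous _ 1) => // x y.
rewrite mul1r; apply: le_trans (ler_dist_enorm _ _) _.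
by rewrite opprB addrA subrK.
Qed.

Definition perp u : plane := \row_i (if i == 0 then - u 0 1 else u 0 0).

Lemma perpE u : perp u 0 0 = - u 0 1 /\ perp u 0 1 = u 0 0.
Proof. by rewrite !mxE. Qed.

Lemma dotp_perp u : dotp (perp u) u = 0.
Proof. by rewrite dotpE !(perpE u).1 !(perpE u).2; ring. Qed.

Lemma enorm_perp u : enorm (perp u) = enorm u.
Proof. by rewrite /enorm !dotpE (perpE u).1 (perpE u).2 mulrNN addrC. Qed.

(** Multiplying through by [dotp u u] avoids any normalisation of [u]. *)
Lemma perp_decomposition u x :
  dotp u u *: x = dotp x u *: u + dotp x (perp u) *: perp u.
Proof.
by apply: plane_eq; rewrite !mxE !dotpE /= (perpE u).1 (perpE u).2; ring.
Qed.

Lemma dotp_pythagoras u x :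
  dotp u u * dotp x x = dotp x u ^+ 2 + dotp x (perp u) ^+ 2.
Proof. by rewrite !dotpE (perpE u).1 (perpE u).2; ring. Qed.

End PlaneGeometry.

(** * Convex bodies and widths *)

Section ConvexBody.
Context (R : realType).
Local Notation plane := 'rV[R]_2.
Variable Omega : set plane.
Hypothesis Omega_compact : compact Omega.
Hypothesis Omega_convex : convex_set Omega.

Lemma convex_body_conv (x y : plane) (k : R) :
  Omega x -> Omega y -> 0 <= k <= 1 -> Omega (k *: x + (1 - k) *: y).
Proof.
move=> Ox Oy /andP[k0 k1].
have k01 : Itv.spec (Itv.num_sem (R := R)) (Itv.Real `[0%Z, 1%Z]) k.
  by rewrite /= /Itv.num_sem num_real/= in_itv/= k0 k1.
have := Omega_convex (Itv.mk k01) (mem_set Ox) (mem_set Oy).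
by rewrite inE.
Qed.

Lemma convex_body_bounded :
  exists2 M : R, 0 < M & forall x, Omega x -> enorm x <= M.
Proof.
have [M [Mr MO]] := compact_bounded Omega_compact.
exists (2 * (`|M| + 1)); first by have := normr_ge0 M; lra.
move=> x Ox; apply: le_trans (enorm_le_normr _) _.
by rewrite ler_wpM2l// MO//; have := ler_norm M; lra.
Qed.

Lemma convex_body_closed : closed Omega.
Proof. exact: compact_closed (@norm_hausdorff _ _) Omega_compact. Qed.

Lemma boundaryE : boundary Omega = Omega `\` interior Omega.
Proof. by rewrite /boundary -(closure_id _).1//; exact: convex_body_closed. Qed.

Lemma boundary_sub : boundary Omega `<=` Omega.
Proof. by rewrite boundaryE => x []. Qed.

(** The homothety of centre [y] and ratio [k] maps a ball of radius [e] about [x] inside [Omega]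
    onto a ball of radius [k * e], again inside [Omega] by convexity. *)
Lemma interior_conv (x y : plane) (k : R) :
  interior Omega x -> Omega y -> 0 < k <= 1 ->
  interior Omega (k *: x + (1 - k) *: y).
Proof.
move=> /nbhs_enormP [e e0 xe] Oy /andP[k0 k1].
apply/nbhs_enormP; exists (k * e); first exact: mulr_gt0.
move=> w hw.
have -> : w = k *: (x + k^-1 *: (w - (k *: x + (1 - k) *: y))) + (1 - k) *: y.
  by apply: plane_eq; rewrite !mxE; field; rewrite gt_eqF.
apply: convex_body_conv => //; last by rewrite ltW.
apply: xe; rewrite addrAC subrr add0r enormZ gtr0_norm ?invr_gt0//.
by rewrite mulrC ltr_pdivrMr// mulrC.
Qed.

Lemma interior_shift (x n : plane) :
  interior Omega x -> exists2 s : R, 0 < s & interior Omega (x + s *: n).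
Proof.
have : open (interior Omega) by exact: open_interior.
rewrite openE => /[apply] /nbhs_enormP [e e0 xe].
have n0 := enorm_ge0 n.
have n1 : 0 < enorm n + 1 by lra.
exists (e / (enorm n + 1)); first exact: divr_gt0.
apply: xe; rewrite addrAC subrr add0r enormZ gtr0_norm ?divr_gt0//.
by rewrite mulrAC -mulrA gtr_pMr// ltr_pdivrMr//; lra.
Qed.

Lemma interior_not_max (x n : plane) : n != 0 -> interior Omega x ->
  exists2 y, Omega y & dotp x n < dotp y n.
Proof.
move=> n0 /(interior_shift n) [s s0 /interior_subset Oy].
exists (x + s *: n) => //; rewrite dotpDl dotpZl ltrDl mulr_gt0//.
by rewrite -enorm_sqr exprn_gt0// enorm_gt0.
Qed.

Lemma linear_max (A : set plane) (n : plane) : compact A -> A !=set0 ->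
  exists2 x, A x & forall y, A y -> dotp y n <= dotp x n.
Proof.
move=> cA A0.
have [x xA xmax] := EVT_max_rV A0 cA
  (continuous_subspaceT (@continuous_dotpl R n)).
by rewrite inE in xA; exists x => // y Ay; apply: xmax; rewrite inE.
Qed.

Lemma boundary_linear_max (n : plane) : Omega !=set0 -> n != 0 ->
  exists2 x, boundary Omega x & forall y, Omega y -> dotp y n <= dotp x n.
Proof.
move=> O0 n0; have [x Ox xmax] := linear_max n Omega_compact O0.
exists x => //; rewrite boundaryE; split=> // Ix.
by have [y /xmax] := interior_not_max n0 Ix; rewrite leNgt => /negP.
Qed.

(** The point is the farthest one of [Omega] on the ray from [m] along [v]. The ray is cut out by
    one equation and one inequality, which makes its trace on [Omega] visibly compact. *)
Lemma boundary_ray (m v : plane) : Omega m -> v != 0 ->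
  exists2 s : R, 0 <= s & boundary Omega (m + s *: v).
Proof.
move=> Om v0.
have vv0 : 0 < dotp v v by rewrite -enorm_sqr exprn_gt0// enorm_gt0.
pose A := Omega `&` ([set x | dotp x (perp v) = dotp m (perp v)] `&`
                     [set x | dotp m v <= dotp x v]).
have cA : compact A.
  apply: compact_closedI => //; apply: closedI.
    have -> : [set x | dotp x (perp v) = dotp m (perp v)] =
              (fun x => dotp x (perp v)) @^-1` [set dotp m (perp v)] by [].
    apply: preimage_closed; last exact: closed_eq.
    by move=> x _; exact: continuous_dotpl.
  have -> : [set x | dotp m v <= dotp x v] =
            (fun x => dotp x v) @^-1` [set r | dotp m v <= r] by [].
  apply: preimage_closed; last exact: closed_ge.
  by move=> x _; exact: continuous_dotpl.
have A0 : A !=set0 by exists m; split => //; split => /=.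
have [x [Ox [/= xp xm]] xmax] := linear_max v cA A0.
have xE : x = m + (dotp (x - m) v / dotp v v) *: v.
  have h : x - m = (dotp v v)^-1 *: (dotp v v *: (x - m)).
    by rewrite scalerA mulVf ?scale1r ?gt_eqF.
  rewrite -[LHS](subrK m) addrC; congr (_ + _).
  rewrite {1}h perp_decomposition (dotpBl x m (perp v)) xp subrr scale0r addr0.
  by rewrite scalerA mulrC.
exists (dotp (x - m) v / dotp v v).
  by apply: divr_ge0; [rewrite dotpBl subr_ge0|exact: ltW].
rewrite -xE boundaryE; split=> // Ix.
have [s s0 Oy] := interior_shift v Ix.
have /xmax : A (x + s *: v).
  split; first exact: interior_subset.
  split => /=; first by rewrite dotpDl dotpZl (dotpC v) dotp_perp mulr0 addr0.
  by rewrite dotpDl dotpZl; apply: le_trans xm _; rewrite lerDl mulr_ge0 ?ltW.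
by rewrite dotpDl dotpZl gerDl leNgt mulr_gt0.
Qed.

End ConvexBody.

(** * Width as an infimum over enclosing strips *)

Section Width.
Context (R : realType).
Local Notation plane := 'rV[R]_2.
Variable Gamma : set plane.
Hypothesis Gamma_nonempty : Gamma !=set0.

Let strips theta := [set d : R | exists a b : R,
  [/\ a <= b, forall x, Gamma x -> a <= dotp x theta <= b & d = b - a]].

Let strips_lbound theta : lbound (strips theta) 0.
Proof. by move=> _ [a [b [ab _ ->]]]; rewrite subr_ge0. Qed.

Lemma width_le_strip (theta : plane) (a b : R) :
  (forall x, Gamma x -> a <= dotp x theta <= b) -> width Gamma theta <= b - a.
Proof.
move=> hab; apply: ge_inf; first by exists 0; exact: strips_lbound.
exists a, b; split => //; have [x /hab /andP[]] := Gamma_nonempty.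
exact: le_trans.
Qed.

Lemma width_ge0 (theta : plane) : 0 <= width Gamma theta.
Proof.
(* If no strip contains [Gamma], [inf] takes its default value 0. *)
have [s0|/set0P s0] := eqVneq (strips theta) set0.
  by rewrite /width -/(strips theta) s0 inf0.
exact: lb_le_inf s0 (@strips_lbound theta).
Qed.

Lemma min_width_le (theta : plane) : unit_circle R theta ->
  min_width Gamma <= width Gamma theta.
Proof.
move=> t1; apply: ge_inf; last by exists theta.
by exists 0 => _ [t _ <-]; exact: width_ge0.
Qed.

Variable M : R.
Hypothesis Gamma_bounded : forall x, Gamma x -> enorm x <= M.

Let strips_nonempty theta : strips theta !=set0.
Proof.
exists (M * enorm theta - - (M * enorm theta)).
exists (- (M * enorm theta)), (M * enorm theta).
have h x : Gamma x -> - (M * enorm theta) <= dotp x theta <= M * enorm theta.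
  move=> Gx; rewrite -ler_norml; apply: le_trans (normr_dotp _ _) _.
  by rewrite ler_wpM2r ?enorm_ge0// Gamma_bounded.
by split => //; have [x /h /andP[]] := Gamma_nonempty; exact: le_trans.
Qed.

Lemma strip_of_width (theta : plane) (e : R) : 0 < e ->
  exists a b : R, (forall x, Gamma x -> a <= dotp x theta <= b) /\
    b - a < width Gamma theta + e.
Proof.
move=> e0; have hi : has_inf (strips theta).
  by split; [exact: strips_nonempty|exists 0; exact: strips_lbound].
have [_ [a [b [_ hab ->]]] lt] := inf_adherent e0 hi.
by exists a, b.
Qed.

(** A strip for [t2] becomes a strip for [t1] once each of its two sides is moved by
    [M * enorm (t1 - t2)]. *)
Lemma width_lipschitz (t1 t2 : plane) :
  `|width Gamma t1 - width Gamma t2| <= 2 * M * enorm (t1 - t2).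
Proof.
wlog suff : t1 t2 / width Gamma t1 <= width Gamma t2 + 2 * M * enorm (t1 - t2).
  move=> h; have := h t1 t2; have := h t2 t1.
  rewrite (enormBC t2) ler_norml => h1 h2.
  by apply/andP; split; lra.
rewrite -lerBlDr; apply: lb_le_inf; first exact: strips_nonempty.
move=> _ [a [b [ab hab ->]]].
rewrite lerBlDr.
have -> : b - a + 2 * M * enorm (t1 - t2) =
  (b + M * enorm (t1 - t2)) - (a - M * enorm (t1 - t2)) by ring.
apply: width_le_strip => x Gx; have /andP[h1 h2] := hab x Gx.
have : `|dotp x (t1 - t2)| <= M * enorm (t1 - t2).
  apply: le_trans (normr_dotp _ _) _.
  by rewrite ler_wpM2r ?enorm_ge0// Gamma_bounded.
rewrite dotpBr ler_norml => /andP[h3 h4].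
by apply/andP; split; lra.
Qed.

End Width.

(** * Chords shorter than the width *)

(** The normal is [p - e], with [e] the point of [K] nearest to [p]: a point of [K] making an acute
    angle with it at [e] would yield points of [K] closer to [p]. *)
Lemma strict_separation (R : realType) (K : set 'rV[R]_2) (p : 'rV[R]_2) :
  compact K -> K !=set0 ->
  (forall x y k, K x -> K y -> 0 <= k <= 1 -> K (k *: x + (1 - k) *: y)) ->
  ~ K p -> exists2 n, n != 0 & forall x, K x -> dotp x n < dotp p n.
Proof.
move=> cK K0 convK Kp.
have [e eK emin] := EVT_min_rV K0 cK
  (continuous_subspaceT (@continuous_enormB R p)).
rewrite inE in eK.
have pe0 : p - e != 0.
  by apply/eqP => /subr0_eq pe; apply: Kp; rewrite pe.
exists (p - e) => // x Kx.
have pe1 : 0 < dotp (p - e) (p - e) by rewrite -enorm_sqr exprn_gt0// enorm_gt0.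
suff : dotp (x - e) (p - e) <= 0.
  by move: pe1; rewrite !dotpBl; lra.
rewrite leNgt; apply/negP => g0.
set g := dotp (x - e) (p - e) in g0.
pose N := dotp (x - e) (x - e).
have N0 : 0 <= N by exact: dotp_ge0.
(* Moving from [e] towards [x] by [t] changes the squared distance to [p] by [t * (t * N - 2 * g)],
   negative as soon as [t * N <= g]. The [+ 1] guards the division. *)
pose t := Num.min 1 (g / (N + 1)).
have t0 : 0 < t by rewrite lt_min ltr01 divr_gt0//; lra.
have t1 : t <= 1 by rewrite ge_min lexx.
have tN : t * N <= g.
  apply: (@le_trans _ _ (g / (N + 1) * N)).
    by rewrite ler_wpM2r// ge_min lexx orbT.
  by rewrite mulrAC ler_pdivrMr ?ler_pM2l//; lra.
have /mem_set/emin : K (t *: x + (1 - t) *: e) by apply: convK => //; rewrite ltW.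
rewrite -(@ler_pXn2r _ 2)// ?nnegrE ?enorm_ge0// !enorm_sqr.
have -> : t *: x + (1 - t) *: e - p = t *: (x - e) - (p - e).
  by apply: plane_eq; rewrite !mxE; ring.
have -> : dotp (t *: (x - e) - (p - e)) (t *: (x - e) - (p - e)) =
    t * (t * N) - (t * g + t * g) + dotp (p - e) (p - e).
  by rewrite /N /g !dotpE !mxE; ring.
have -> : dotp (e - p) (e - p) = dotp (p - e) (p - e).
  by rewrite !dotpE !mxE; ring.
suff : t * (t * N) < t * g + t * g by lra.
by rewrite -mulrDr ltr_pM2l//; lra.
Qed.

Section Chords.
Context (R : realType).
Local Notation plane := 'rV[R]_2.
Variable Omega : set plane.
Hypothesis Omega_compact : compact Omega.
Hypothesis Omega_convex : convex_set Omega.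
Hypothesis Omega_domain : interior Omega !=set0.

Let Omega_nonempty : Omega !=set0.
Proof. by have [z /interior_subset] := Omega_domain; exists z. Qed.

Lemma plane_nonzero : (const_mx 1 : plane) != 0.
Proof.
by apply/eqP => /matrixP/(_ 0 0)/eqP; rewrite !mxE oner_eq0.
Qed.

Lemma boundary_nonempty : boundary Omega !=set0.
Proof.
have [x Gx _] := boundary_linear_max Omega_compact Omega_nonempty plane_nonzero.
by exists x.
Qed.

(** A slightly longer vector [k *: d] is still shorter than the width. If it is a difference of two
    points of [Omega], contracting these towards [z0] with ratio [k^-1] turns the difference into
    [d] and makes both points interior. Otherwise a normal separating it from the difference body
    gives a direction of width at most [k * enorm d]. *)
Lemma interior_chord (d : plane) : enorm d < min_width (boundary Omega) ->
  exists2 z, interior Omega z & interior Omega (z + d).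
Proof.
set w := min_width _ => dw.
have [z0 Iz0] := Omega_domain.
have [->|d0] := eqVneq d 0; first by exists z0; rewrite ?addr0.
have nd := enorm_gt0 d0.
(* The mean of 1 and [w / enorm d], hence strictly between them. *)
pose k := (1 + w / enorm d) / 2.
have k1 : 1 < k by rewrite /k ltr_pdivlMr// mul1r -ltrBlDl ltr_pdivlMr//; lra.
have kd : k * enorm d < w.
  rewrite /k mulrAC ltr_pdivrMr// mulrDl divfK ?gt_eqF//; lra.
clearbody k; pose K := [set xy.1 - xy.2 | xy in Omega `*` Omega].
have cK : compact K.
  apply: continuous_compact; last exact: compact_setX.
  apply: continuous_subspaceT => xy.
  by apply: cvgB; [exact: cvg_fst|exact: cvg_snd].
have K0 : K !=set0.
  by have [x Ox] := Omega_nonempty; exists (x - x), (x, x).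
have convK (x y : plane) (l : R) :
    K x -> K y -> 0 <= l <= 1 -> K (l *: x + (1 - l) *: y).
  move=> [[x1 x2] /= [Ox1 Ox2] <-] [[y1 y2] /= [Oy1 Oy2] <-] l01.
  exists (l *: x1 + (1 - l) *: y1, l *: x2 + (1 - l) *: y2) => /=.
    by split; exact: convex_body_conv.
  by apply: plane_eq; rewrite !mxE; ring.
have [[[x y] /= [Ox Oy] xy]|nK] := pselect (K (k *: d)).
  pose t := 1 - k^-1.
  have kV : k^-1 < 1 by rewrite invf_lt1//; lra.
  have kV0 : 0 < k^-1 by rewrite invr_gt0; lra.
  have t01 : 0 < t <= 1 by apply/andP; rewrite /t; split; lra.
  have tE : 1 - t = k^-1 by rewrite /t; ring.
  exists (t *: z0 + (1 - t) *: y); first exact: interior_conv.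
  have -> : t *: z0 + (1 - t) *: y + d = t *: z0 + (1 - t) *: x.
    have -> : d = (1 - t) *: (x - y).
      by rewrite xy scalerA tE mulVf ?scale1r//; lra.
    by apply: plane_eq; rewrite !mxE; ring.
  exact: interior_conv.
have [n n0 nsep] := strict_separation cK K0 convK nK.
have [x Ox xmax] := linear_max n Omega_compact Omega_nonempty.
have [y Oy ymin] := linear_max (- n) Omega_compact Omega_nonempty.
have nn := enorm_gt0 n0.
pose theta := (enorm n)^-1 *: n.
have theta1 : unit_circle R theta.
  by rewrite /unit_circle /= enormZ gtr0_norm ?invr_gt0// mulVf// gt_eqF.
suff : width (boundary Omega) theta <= k * enorm d.
  move=> h; have := min_width_le (boundary Omega) theta1.
  by rewrite -/w => /le_trans/(_ h); rewrite leNgt kd.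
apply: (@le_trans _ _ (dotp x theta - dotp y theta)).
  apply: (width_le_strip boundary_nonempty) => u Gu.
  have Ou : Omega u by exact: (boundary_sub Omega_compact).
  have := xmax _ Ou; have := ymin _ Ou.
  rewrite !dotpNr lerN2 !dotpZr => h1 h2.
  by rewrite !ler_pM2l ?invr_gt0// h1 h2.
rewrite -dotpBl dotpZr.
have : dotp (x - y) n < dotp (k *: d) n by apply: nsep; exists (x, y).
move=> h; have := ler_dotp d n => h2.
rewrite mulrC ler_pdivrMr//; apply: le_trans (ltW h) _.
by rewrite dotpZl -mulrA ler_wpM2l//; lra.
Qed.

(* [visible v x]: the point [x] can be pushed into the interior in the
   direction [v], i.e. every outer normal at [x] makes an obtuse angle
   with [v]. *)
Definition visible (v : plane) : set plane :=
  [set x | exists2 s : R, 0 < s & interior Omega (x + s *: v)].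

Lemma open_visible v : open (visible v).
Proof.
rewrite openE => x [s s0].
have : open (interior Omega) by exact: open_interior.
rewrite openE => /[apply] /nbhs_enormP [e e0 he].
apply/nbhs_enormP; exists e => // y yx; exists s => //.
by apply: he; rewrite opprD addrACA subrr addr0.
Qed.

Lemma boundary_not_visible2 v w :
  ~ (forall x, boundary Omega x -> visible v x \/ visible w x).
Proof.
move=> h.
have [n n0 [vn wn]] : exists2 n : plane, n != 0 & 0 <= dotp v n /\ 0 <= dotp w n.
  have [->|v0] := eqVneq v 0.
    have [->|w0] := eqVneq w 0.
      exists (const_mx 1); first exact: plane_nonzero.
      by split; rewrite dotpE !mxE !mul0r addr0.
    exists w => //; split; last exact: dotp_ge0.
    by rewrite dotpE !mxE !mul0r addr0.
  have p0 : perp v != 0.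
    apply/eqP => /(congr1 (@enorm R)); rewrite enorm_perp enorm0 => /enorm_eq0 ve.
    by rewrite ve eqxx in v0.
  have [wp|wp] := leP 0 (dotp w (perp v)).
    by exists (perp v); rewrite // (dotpC v) dotp_perp.
  exists (- perp v); first by rewrite oppr_eq0.
  by rewrite !dotpNr (dotpC v) dotp_perp oppr0 oppr_ge0 (ltW wp).
have [x Gx xmax] := boundary_linear_max Omega_compact Omega_nonempty n0.
have [u un] : exists2 u, 0 <= dotp u n & visible u x.
  by have [] := h _ Gx; [exists v|exists w].
case=> s s0 /(interior_not_max n0) [y /xmax].
rewrite dotpDl dotpZl leNgt => /negP yx xy; apply: yx.
by apply: le_lt_trans xy; rewrite lerDl mulr_ge0// ltW.
Qed.

End Chords.

(** * Arcs of a Jordan curve *)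

Section Arcs.
Context (R : realType).
Local Notation plane := 'rV[R]_2.
Variables (Gamma : set plane) (c : R -> plane).
Hypothesis c_jordan : jordan_parametrization Gamma c.

Lemma jordan_continuous : continuous c.
Proof. by case: c_jordan. Qed.

Lemma jordan_mem t : Gamma (c t).
Proof. by case: c_jordan => _ _ <-; exists t. Qed.

Lemma jordan_periodic t (k : int) : c (t + k%:~R) = c t.
Proof. by case: c_jordan => _ h _; apply/esym/h; exists k. Qed.

Lemma jordan_period1 t : c (t + 1) = c t.
Proof. exact: (jordan_periodic t 1). Qed.

Lemma jordan_inj s t : s < t < s + 1 -> c s <> c t.
Proof.
case: c_jordan => _ h _ /andP[st ts] /h [k tE].
move: st ts; rewrite tE ltrDl ltrD2l ltr0z ltrz1.
lia.
Qed.

Lemma jordan_lift (a : R) x : Gamma x -> exists2 t, a <= t < a + 1 & c t = x.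
Proof.
case: c_jordan => _ _ <- [s _ <-].
have /andP[h1 h2] := floor_itv (s - a).
exists (s + (- Num.floor (s - a))%:~R); last exact: jordan_periodic.
by move: h1 h2; rewrite rmorphN rmorphD /= => h1 h2; apply/andP; split; lra.
Qed.

Lemma arc_compact (a b : R) : compact (c @` `[a, b]).
Proof.
apply: continuous_compact; last exact: segment_compact.
exact: continuous_subspaceT jordan_continuous.
Qed.

Lemma arc_connected (A : set R) : is_interval A -> connected (c @` A).
Proof.
move=> iA; apply: connected_continuous_connected.
  exact/connected_intervalP.
exact: continuous_subspaceT jordan_continuous.
Qed.

(** The complementary arc is expressed through the set and its endpoints alone, hence independently
    of [c]. The endpoints are added back because the complement of a closed arc lacks them. *)
Lemma arc_complement (a b : R) : a <= b <= a + 1 ->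
  c @` `[b, a + 1] = (Gamma `\` (c @` `[a, b])) `|` [set c a; c b].
Proof.
move=> /andP[ab ba]; apply/seteqP; split=> x.
- case=> t; rewrite /= in_itv/= => /andP[bt ta] <-.
  have [->|tb] := eqVneq t b; first by right; right.
  have [->|ta1] := eqVneq t (a + 1); first by right; left; rewrite jordan_period1.
  left; split; first exact: jordan_mem.
  case=> s; rewrite /= in_itv/= => /andP[as_ sb]; apply: jordan_inj.
  have {}bt : b < t by rewrite lt_def tb.
  have {}ta : t < a + 1 by rewrite lt_def eq_sym ta1.
  by apply/andP; split; lra.
- case=> [[Gx nx]|[->|->]].
  + have [t /andP[at_ ta] tx] := jordan_lift a Gx.
    exists t => //=; rewrite in_itv/= (ltW ta) andbT leNgt; apply/negP => tb.
    by apply: nx; exists t => //=; rewrite in_itv/= at_ ltW.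
  + by exists (a + 1); rewrite ?jordan_period1//= in_itv/= ba lexx.
  + by exists b => //=; rewrite in_itv/= lexx.
Qed.

End Arcs.

(** * One of the two arcs cut off by a short chord is visible *)

Section VisibleArcs.
Context (R : realType).
Local Notation plane := 'rV[R]_2.
Variable Omega : set plane.
Hypothesis Omega_compact : compact Omega.
Hypothesis Omega_convex : convex_set Omega.
Variable c : R -> plane.
Hypothesis c_jordan : jordan_parametrization (boundary Omega) c.

Let cross (u v : plane) := dotp (perp u) v.

(* In the affine coordinates [x = p + l d + m v], with [d = q - p], the boundary
   points other than [p] and [q] satisfying [0 <= l <= 1] and [m <= 1] are those
   satisfying [0 < l < 1] and [m < 1], so they form a relatively clopen set. *)
Lemma visible_arc (a b : R) (v : plane) : a <= b <= a + 1 -> c a <> c b ->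
  interior Omega (c a + v) -> interior Omega (c b + v) ->
  c @` `[a, b] `<=` visible Omega v \/ c @` `[b, a + 1] `<=` visible Omega v.
Proof.
move=> /andP[ab ba] pq Ip Iq.
set p := c a in pq Ip *; set q := c b in pq Iq *.
pose d := q - p.
have qE : q = p + d by rewrite /d addrC subrK.
have Gsub := boundary_sub Omega_compact.
have Gp : boundary Omega p by exact: (jordan_mem c_jordan).
have Gq : boundary Omega q by exact: (jordan_mem c_jordan).
have GI x : boundary Omega x -> ~ interior Omega x by move=> [].
have d0 : dotp d d != 0.
  by apply/eqP => /dotp_eq0 d0; apply: pq; rewrite qE d0 addr0.
have D0 : cross d v != 0.
  (* If [v] were parallel to [d], then [q] would lie between [p] and the interior point [q + v], or
     [p] between [q] and [p + v]. *)
  apply/eqP => D0.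
  pose k := dotp v d / dotp d d.
  have vE : v = k *: d.
    have := perp_decomposition d v.
    rewrite (dotpC v (perp d)) -/(cross d v) D0 scale0r addr0 => h.
    by rewrite /k mulrC -scalerA -h scalerA mulVf// scale1r.
  have [k0|k0] := leP 0 k.
    apply: (GI q Gq).
    have -> : q = (1 + k)^-1 *: (q + v) + (1 - (1 + k)^-1) *: p.
      by apply: plane_eq; rewrite vE qE !mxE; field; lra.
    apply: (interior_conv Omega_convex Iq); first exact: Gsub.
    have k1 : 0 < 1 + k by lra.
    by rewrite invr_gt0 invf_le1// k1 /=; lra.
  apply: (GI p Gp).
  have -> : p = (1 - k)^-1 *: (p + v) + (1 - (1 - k)^-1) *: q.
    by apply: plane_eq; rewrite vE qE !mxE; field; lra.
  apply: (interior_conv Omega_convex Ip); first exact: Gsub.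
  have k1 : 0 < 1 - k by lra.
  by rewrite invr_gt0 invf_le1// k1 /=; lra.
(* Coordinates in the basis [d], [v], by Cramer's rule. *)
pose l x := cross (x - p) v / cross d v.
pose m x := cross d (x - p) / cross d v.
have xE x : x = p + l x *: d + m x *: v.
  apply: plane_eq; rewrite /l /m; move: D0; rewrite /cross !dotpE !mxE /=;
  by move=> D0; field.
have lE s t : l (p + s *: d + t *: v) = s.
  rewrite /l; move: D0; rewrite /cross !dotpE !mxE /= => D0; by field.
have mE s t : m (p + s *: d + t *: v) = t.
  rewrite /m; move: D0; rewrite /cross !dotpE !mxE /= => D0; by field.
have Iv s : 0 <= s <= 1 -> interior Omega (p + s *: d + v).
  move=> /andP[s0 s1].
  have [->|s0'] := eqVneq s 0; first by rewrite scale0r addr0.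
  have -> : p + s *: d + v = s *: (q + v) + (1 - s) *: (p + v).
    by apply: plane_eq; rewrite qE !mxE; ring.
  apply: (interior_conv Omega_convex Iq); first exact: interior_subset.
  by rewrite s1 lt_def s0' s0.
pose U := [set x | [/\ 0 < l x, l x < 1 & m x < 1]].
pose F := [set x | [/\ 0 <= l x, l x <= 1 & m x <= 1]].
have FU x : boundary Omega x -> x <> p -> x <> q -> F x -> U x /\ m x <= 0.
  move=> Gx xp xq [l0 l1 m1].
  (* For [0 < m x <= 1] the point lies between the chord and its interior translate, hence is
     interior. *)
  have m0 : m x <= 0.
    rewrite leNgt; apply/negP => m0; apply: (GI x Gx).
    have -> : x = m x *: (p + l x *: d + v) + (1 - m x) *: (p + l x *: d).
      by rewrite {1}(xE x); apply: plane_eq; rewrite !mxE; ring.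
    apply: (interior_conv Omega_convex); first by apply: Iv; rewrite l0.
      have -> : p + l x *: d = l x *: q + (1 - l x) *: p.
        by apply: plane_eq; rewrite qE !mxE; ring.
      apply: (convex_body_conv Omega_convex); [exact: Gsub|exact: Gsub|].
      by rewrite l0.
    by rewrite m0.
  (* A boundary point strictly behind an endpoint [r] on the line through [r] along [v] would put
     [r] between itself and the interior point [r + v]. This excludes the two sides [l x = 0] and
     [l x = 1]. *)
  have key r : interior Omega (r + v) -> boundary Omega r -> x <> r ->
      x = r + m x *: v -> False.
    move=> Ir Gr xr xrE; apply: (GI r Gr).
    have -> : r = (- m x / (1 - m x)) *: (r + v) + (1 - - m x / (1 - m x)) *: x.
      by rewrite {5}xrE; apply: plane_eq; rewrite !mxE; field; lra.
    apply: (interior_conv Omega_convex Ir); first exact: Gsub.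
    have mx : m x < 0.
      rewrite lt_def m0 andbT; apply/eqP => mx.
      by apply: xr; rewrite xrE -mx scale0r addr0.
    have mx1 : 0 < 1 - m x by lra.
    by rewrite divr_gt0 ?oppr_gt0//= ler_pdivrMr//; lra.
  split=> //; split; last lra.
    rewrite lt_def l0 andbT; apply/eqP => lx.
    by apply: (key p) => //; rewrite {1}(xE x) lx scale0r addr0.
  rewrite lt_def l1 andbT; apply/eqP => lx.
  by apply: (key q) => //; rewrite {1}(xE x) -lx scale1r qE.
have FV x : boundary Omega x -> x <> p -> x <> q -> F x -> visible Omega v x.
  move=> Gx xp xq Fx; have [[l0 l1 _] m0] := FU x Gx xp xq Fx.
  exists (1 - m x); first lra.
  have -> : x + (1 - m x) *: v = p + l x *: d + v.
    by rewrite {1}(xE x); apply: plane_eq; rewrite !mxE; ring.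
  by apply: Iv; rewrite !ltW.
have cl : continuous l.
  have -> : l = (fun x => dotp (x - p) ((cross d v)^-1 *: - perp v)).
    apply/funext => x; rewrite dotpZr dotpNr mulrC /l /cross; congr (_ * _).
    by rewrite !dotpE !mxE /=; ring.
  exact: continuous_dotpBl.
have cm : continuous m.
  have -> : m = (fun x => dotp (x - p) ((cross d v)^-1 *: perp d)).
    by apply/funext => x; rewrite dotpZr mulrC /m /cross dotpC.
  exact: continuous_dotpBl.
have oU : open U.
  have -> : U = (l @^-1` [set r | 0 < r] `&` l @^-1` [set r | r < 1]) `&`
                m @^-1` [set r | r < 1].
    by apply/seteqP; split=> x; [case|case=> -[]].
  by apply: openI; [apply: openI|]; apply: open_comp; do ?[by move=> *; exact: cl];
    do ?[by move=> *; exact: cm]; by [exact: open_gt|exact: open_lt].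
have cF : closed F.
  have -> : F = (l @^-1` [set r | 0 <= r] `&` l @^-1` [set r | r <= 1]) `&`
                m @^-1` [set r | r <= 1].
    by apply/seteqP; split=> x; [case|case=> -[]].
  by apply: closedI; [apply: closedI|]; apply: preimage_closed;
    do ?[by move=> *; exact: cl]; do ?[by move=> *; exact: cm];
    by [exact: closed_ge|exact: closed_le].
have UF : U `<=` F by move=> x [*]; split; exact: ltW.
have conn (A : set plane) : connected A -> A `<=` boundary Omega ->
    ~ A p -> ~ A q -> A `&` F !=set0 -> A `<=` visible Omega v.
  move=> cA AG Ap Aq AF.
  have AFE : A `&` F = A.
    apply: cA => //; last by exists F.
    exists U => //; apply/seteqP; split=> x [Ax Fx]; split=> //; last exact: UF.
    by case: (FU x) => //; [exact: AG|move=> xp; rewrite xp in Ax|move=> xq; rewrite xq in Ax].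
  move=> x Ax; have [_ Fx] : (A `&` F) x by rewrite AFE.
  by apply: FV => //; [exact: AG|move=> xp; rewrite xp in Ax|move=> xq; rewrite xq in Ax].
have Vp : visible Omega v p by exists 1; [exact: ltr01|rewrite scale1r].
have Vq : visible Omega v q by exists 1; [exact: ltr01|rewrite scale1r].
have v0 : - v != 0.
  rewrite oppr_eq0; apply/eqP => v0.
  by apply: (GI p Gp); move: Ip; rewrite v0 addr0.
(* Walking from the midpoint of the chord against [v] reaches a boundary point of [F]; the arc that
   contains it is the visible one. *)
have mid : Omega (p + 2^-1 *: d).
  have -> : p + 2^-1 *: d = 2^-1 *: q + (1 - 2^-1) *: p.
    by apply: plane_eq; rewrite qE !mxE; ring.
  apply: (convex_body_conv Omega_convex); [exact: Gsub|exact: Gsub|].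
  by apply/andP; split; lra.
have [s s0 Gx] := boundary_ray Omega_compact mid v0.
set x := _ + s *: - v in Gx.
have xE' : x = p + 2^-1 *: d + (- s) *: v by rewrite /x scalerN scaleNr.
have Fx : F x by rewrite /F /= xE' lE mE; split; lra.
have [t /andP[at_ ta] tx] := jordan_lift c_jordan a Gx.
have xp : x <> p.
  by move=> xp; have := lE 0 0; rewrite !scale0r !addr0 -xp xE' lE; lra.
have xq : x <> q.
  by move=> xq; have := lE 1 0; rewrite scale0r scale1r addr0 -qE -xq xE' lE; lra.
have {}at_ : a < t by rewrite lt_def at_ andbT; apply/eqP => tE; apply: xp; rewrite -tx tE.
have [tb|bt] := ltP t b; [left|right].
- have h : c @` `]a, b[ `<=` visible Omega v.
    apply: conn.
    + apply: (arc_connected c_jordan); exact: interval_is_interval.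
    + by move=> _ [u _ <-]; exact: (jordan_mem c_jordan).
    + case=> u; rewrite /= in_itv/= => /andP[au ub] /esym; apply: (jordan_inj c_jordan).
      by apply/andP; split; lra.
    + case=> u; rewrite /= in_itv/= => /andP[au ub]; apply: (jordan_inj c_jordan).
      by apply/andP; split; lra.
    + by exists x; split=> //; exists t => //=; rewrite in_itv/= at_.
  move=> _ [u + <-]; rewrite /= in_itv/= => /andP[au ub].
  have [->|ua] := eqVneq u a; first exact: Vp.
  have [->|ub'] := eqVneq u b; first exact: Vq.
  by apply: h; exists u => //=; rewrite in_itv/= !lt_def ua au eq_sym ub' ub.
- have {}bt : b < t by rewrite lt_def bt andbT; apply/eqP => tE; apply: xq; rewrite -tx tE.
  have h : c @` `]b, a + 1[ `<=` visible Omega v.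
    apply: conn.
    + apply: (arc_connected c_jordan); exact: interval_is_interval.
    + by move=> _ [u _ <-]; exact: (jordan_mem c_jordan).
    + case=> u; rewrite /= in_itv/= => /andP[au ub] /esym; apply: (jordan_inj c_jordan).
      by apply/andP; split; lra.
    + case=> u; rewrite /= in_itv/= => /andP[au ub] /esym; apply: (jordan_inj c_jordan).
      by apply/andP; split; lra.
    + by exists x; split=> //; exists t => //=; rewrite in_itv/= bt.
  move=> _ [u + <-]; rewrite /= in_itv/= => /andP[au ub].
  have [->|ua] := eqVneq u b; first exact: Vq.
  have [->|ub'] := eqVneq u (a + 1).
    by rewrite (jordan_period1 c_jordan); exact: Vp.
  by apply: h; exists u => //=; rewrite in_itv/= !lt_def ua au eq_sym ub' ub.
Qed.

End VisibleArcs.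

(** * Hausdorff length *)

Section Length.
Context (R : realType).
Local Notation plane := 'rV[R]_2.
Implicit Types (A B : set plane).

Lemma diameter_ge0 A : (0 <= diameter A)%E.
Proof. by apply: ereal_sup_ubound; left. Qed.

Lemma diameter_ge A x y : A x -> A y -> ((enorm (x - y))%:E <= diameter A)%E.
Proof. by move=> Ax Ay; apply: ereal_sup_ubound; right; exists x => //; exists y. Qed.

Lemma diameter_le A (d : R) : 0 <= d ->
  (forall x y, A x -> A y -> enorm (x - y) <= d) -> (diameter A <= d%:E)%E.
Proof.
move=> d0 h; apply: ge_ereal_sup => _ [->|[x Ax [y Ay <-]]]; rewrite lee_fin//.
exact: h.
Qed.

Lemma diameter0 : diameter (set0 : set plane) = 0%E.
Proof. by apply/eqP; rewrite eq_le diameter_ge0 diameter_le. Qed.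

(* The distance to [x] is [1]-Lipschitz and maps [A] onto a superset of
   [[0, e[], whose Lebesgue measure bounds the length from below up to a factor. *)
Lemma length_ge_radius A (x : plane) (e : R) : 0 < e ->
  (forall r, 0 <= r < e -> exists2 y, A y & enorm (y - x) = r) ->
  ((e / 2)%:E <= length A)%E.
Proof.
(* The length is a supremum over scales, so one scale suffices; a finite one also keeps all
   diameters finite. *)
move=> e0 hA; apply: (@le_trans _ _ (length_at_scale 1 A)); last first.
  by apply: ereal_sup_ubound; exists 1 => //=.
apply: le_ereal_inf_tmp => _ [U [AU dU] <-].
have dfin k : diameter (U k) = (fine (diameter (U k)))%:E.
  rewrite fineK// ge0_fin_numE ?diameter_ge0//.
  by apply: le_lt_trans (dU k) _; rewrite ltry.
pose d k := fine (diameter (U k)).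
have d0 k : 0 <= d k by rewrite -lee_fin -dfin diameter_ge0.
(* An arbitrary point of [U k] serves as centre. For an empty [U k] the default 0 is harmless: the
   interval is then a single point, of measure 0. *)
pose f k := enorm (xget 0 (U k) - x).
pose I k := [set` `[f k - d k, f k + d k]%R] : set (measurableTypeR R).
have cover : [set` `[0, e[%R] `<=` \bigcup_k I k.
  move=> r; rewrite /= in_itv/= => /hA [y Ay yr].
  have [k _ Uy] := AU _ Ay; exists k => //; rewrite /I /= in_itv/=.
  have Ux : U k (xget 0 (U k)) by exact: xgetI Uy.
  have h : enorm (y - xget 0 (U k)) <= d k.
    by rewrite -lee_fin -dfin; exact: diameter_ge.
  have := ler_dist_enorm (y - x) (xget 0 (U k) - x).
  rewrite opprB addrA subrK -yr ler_norml -/(f k) => /andP[h1 h2].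
  by apply/andP; split; lra.
have : (lebesgue_measure ([set` `[0%R, e[%R] : set (measurableTypeR R)) <=
        \sum_(0 <= k <oo) lebesgue_measure (I k))%E.
  by apply: measure_sigma_subadditive => // k; exact: measurable_itv.
rewrite lebesgue_measure_itv/= lte_fin e0 oppr0 adde0.
under eq_eseriesr.
  move=> k _; rewrite lebesgue_measure_itv/=.
  rewrite (_ : (if _ then _ else _) = 2%:E * diameter (U k))%E; last first.
    rewrite dfin -/(d k) -EFinM lte_fin; case: ifPn => h.
      by rewrite -EFinB; congr (_%:E); ring.
    rewrite (_ : d k = 0) ?mulr0//; have := d0 k; move: h; rewrite -leNgt; lra.
  over.
rewrite nneseriesZl; last by move=> *; exact: diameter_ge0.
by rewrite EFinM lee_pdivrMr// muleC.
Qed.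

(** A certificate for [length A <= L] by finite covers at every scale. With lists, a union amounts
    to a concatenation, and the default [set0] pads the cover to a sequence at no cost. *)
Definition finely_covered (L : R) A := forall d : R, 0 < d ->
  exists s : seq (set plane), [/\ A `<=` \bigcup_k nth set0 s k,
    forall k, (diameter (nth set0 s k) <= d%:E)%E &
    (\sum_(U <- s) diameter U <= L%:E)%E].

Lemma finely_covered_length L A : finely_covered L A -> (length A <= L%:E)%E.
Proof.
move=> h; apply: ge_ereal_sup => _ [d /= d0 <-].
have [s [As sd sL]] := h d d0.
apply: le_trans sL.
apply: ereal_inf_lbound; exists (nth set0 s) => //.
rewrite (nneseries_split 0 (size s)); last by move=> *; exact: diameter_ge0.
rewrite add0n eseries0 ?adde0; last first.
  by move=> k sk _; rewrite nth_default// diameter0.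
by rewrite [RHS](big_nth set0).
Qed.

Lemma finely_covered_sub L A B : A `<=` B -> finely_covered L B ->
  finely_covered L A.
Proof.
by move=> AB h d /h [s [Bs sd sL]]; exists s; split=> //; exact: subset_trans AB Bs.
Qed.

Lemma finely_coveredU L1 L2 A B : finely_covered L1 A -> finely_covered L2 B ->
  finely_covered (L1 + L2) (A `|` B).
Proof.
move=> h1 h2 d d0; have [s1 [As sd1 sL1]] := h1 d d0; have [s2 [Bs sd2 sL2]] := h2 d d0.
exists (s1 ++ s2); split.
- move=> x [/As|/Bs] [k _ kx].
    exists k => //; rewrite nth_cat; case: ltnP => // sk.
    by move: kx; rewrite nth_default.
  by exists (size s1 + k)%N => //; rewrite nth_cat ltnNge leq_addr /= addKn.
- by move=> k; rewrite nth_cat; case: ifP.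
- by rewrite big_cat EFinD; exact: leeD.
Qed.

Variables (c : R -> plane) (K : R).
Hypothesis K_ge0 : 0 <= K.
Hypothesis c_lipschitz : forall s t, enorm (c s - c t) <= K * `|s - t|.

Lemma arc_finely_covered (a b : R) : a <= b ->
  finely_covered (K * (b - a)) (c @` `[a, b]).
Proof.
move=> ab d d0.
(* The successor makes [N] exceed [K * (b - a) / d], so that pieces of parameter length [h] have
   diameter at most [d]. *)
pose N := (Num.truncn (K * (b - a) / d)).+1.
have N0 : 0 < N%:R :> R by rewrite ltr0n.
pose h := (b - a) / N%:R.
have h0 : 0 <= h by rewrite divr_ge0 ?subr_ge0// ltW.
have hd : K * h <= d.
  rewrite /h mulrA ler_pdivrMr// [leRHS]mulrC -ler_pdivrMr//.
  exact/ltW/truncnS_gt.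
have NhE : N%:R * h = b - a by rewrite /h mulrC divfK ?gt_eqF.
pose P k := c @` `[a + k%:R * h, a + k.+1%:R * h].
have dP k : (diameter (P k) <= (K * h)%:E)%E.
  apply: diameter_le; first exact: mulr_ge0.
  move=> _ _ [s + <-] [t + <-]; rewrite /= !in_itv/= => /andP[s1 s2] /andP[t1 t2].
  apply: le_trans (c_lipschitz _ _) _; apply: ler_wpM2l => //.
  move: s1 s2 t1 t2; rewrite -natr1 mulrDl mul1r => s1 s2 t1 t2.
  by rewrite ler_norml; apply/andP; split; lra.
exists (mkseq P N); split.
- move=> _ [t + <-]; rewrite /= in_itv/= => /andP[at_ tb].
  have [ba|ba] := eqVneq b a.
    exists 0%N => //; rewrite nth_mkseq//; exists t => //=.
    rewrite in_itv/= mul0r addr0 at_ mul1r /=.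
    by rewrite (le_trans tb)// ba lerDl.
  have h1 : 0 < h by rewrite divr_gt0// subr_gt0 lt_def ba.
  (* At [t = b] the truncation used below would give the index [N], one past the last piece. *)
  have [tb'|tb'] := eqVneq t b.
    exists N.-1 => //; rewrite nth_mkseq//; exists t => //=.
    rewrite in_itv/= tb'; apply/andP; split; last first.
      by rewrite -[_.+1]/N NhE; lra.
    have : N.-1%:R * h <= N%:R * h by rewrite ler_wpM2r// ler_nat leqnSn.
    by rewrite NhE /=; lra.
  have tb2 : t < b by rewrite lt_def eq_sym tb' tb.
  have x0 : 0 <= (t - a) / h by rewrite divr_ge0// subr_ge0.
  have /andP[k1 k2] := truncn_itv x0.
  set k := Num.truncn _ in k1 k2.
  exists k => //; rewrite nth_mkseq.
    exists t => //=; rewrite in_itv/= -lerBrDl -ler_pdivlMr// k1 /=.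
    by rewrite -lerBlDl -ler_pdivrMr// ltW.
  rewrite -(ltr_nat R); apply: le_lt_trans k1 _.
  by rewrite ltr_pdivrMr// NhE; lra.
- move=> k; have [kN|kN] := ltnP k N.
    by rewrite nth_mkseq//; apply: le_trans (dP k) _; rewrite lee_fin.
  by rewrite nth_default ?size_mkseq// diameter0 lee_fin ltW.
- rewrite big_map.
  apply: (@le_trans _ _ (\sum_(k <- iota 0 N) (K * h)%:E)%E).
    by apply: lee_sum => k _; exact: dP.
  rewrite sumEFin lee_fin big_const_seq count_predT size_iota iter_addr addr0.
  by rewrite -mulr_natr -mulrA /h divfK ?gt_eqF.
Qed.

End Length.

(** * The lower bound *)

Section LowerBound.
Context (R : realType).
Local Notation plane := 'rV[R]_2.

(** A Lebesgue number for the cover of [K] by the single open set [U]. *)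
Lemma compact_open_gap (K U : set plane) : compact K -> open U -> K `<=` U ->
  exists2 d : R, 0 < d & forall x y, K y -> enorm (x - y) < d -> U x.
Proof.
move=> /compact_near_coveringP cK oU KU.
pose P (d : R) (y : plane) := forall x, enorm (x - y) < d -> U x.
have : \forall d \near 0^'+, K `<=` P d.
  apply: cK => y /KU Uy.
  have /nbhs_enormP [e e0 he] : nbhs y U by exact: open_nbhs_nbhs.
  exists (([set x | enorm (x - y) < e / 2] : set plane), [set d | d < e / 2]).
    split => /=; first by apply/nbhs_enormP; exists (e / 2) => //; rewrite divr_gt0.
    exact: nbhs_right_lt (divr_gt0 e0 _).
  case=> x d /= [xy de] u ux; apply: he.
  apply: le_lt_trans (ler_enorm_dist u x y) _; lra.
move=> h; have : \forall d \near 0^'+, 0 < d /\ K `<=` P d.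
  near=> d; split; near: d => //; exact: nbhs_right_gt.
move=> /filter_ex [d [d0 hd]].
by exists d => // x y Ky; exact: hd.
Unshelve. all: by end_near. Qed.

(** By connectedness the distance to [x] takes on [A] every value in [[0, e[], and it does so at
    points of [Z]. This converts smallness of length into closeness of sets. *)
Lemma connected_escape_length (A Z : set plane) (x a : plane) (e : R) :
  0 < e -> connected A -> A x -> A a -> e <= enorm (a - x) ->
  (forall y, A y -> enorm (y - x) < e -> Z y) -> ((e / 2)%:E <= length Z)%E.
Proof.
move=> e0 cA Ax Aa ea AZ; apply: (@length_ge_radius _ _ x) => // r /andP[r0 re].
have : connected ((fun y => enorm (y - x)) @` A).
  apply: connected_continuous_connected => //.
  exact: continuous_subspaceT (@continuous_enormB R x).
move=> /connected_intervalP/(_ 0 (enorm (a - x))) h.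
have [y Ay yr] : ((fun y => enorm (y - x)) @` A) r.
  apply: h; last by rewrite r0 (le_trans (ltW re) ea).
    by exists x; rewrite // subrr enorm0.
  by exists a.
by exists y => //; apply: AZ; rewrite // yr.
Qed.

(** * Arcs contained in an open set remain so at nearby times *)

Section Persistence.
Variables (p q : R -> plane) (C X : R -> set plane).
Hypothesis p_cont : {within `[0, 1], continuous p}.
Hypothesis q_cont : {within `[0, 1], continuous q}.
Hypothesis C_cont : forall t : R, 0 <= t <= 1 ->
  length (C s `+` C t) @[s --> within `[0, 1] (nbhs t)] --> 0%E.
Hypothesis X_compact : forall t, 0 <= t <= 1 -> compact (X t).
Hypothesis X_connected : forall t, 0 <= t <= 1 -> connected (X t).
Hypothesis X_ends : forall t, 0 <= t <= 1 -> X t (p t) /\ X t (q t).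
Hypothesis X_sub : forall s t, 0 <= s <= 1 -> 0 <= t <= 1 ->
  X s `\` X t `<=` (C s `+` C t) `|` [set p s; q s].

Let near_end (f : R -> plane) (t d : R) : {within `[0, 1], continuous f} ->
  0 <= t <= 1 -> 0 < d ->
  \forall s \near within `[0, 1] (nbhs t), enorm (f s - f t) < d.
Proof.
move=> /subspace_continuousP cf t01 d0.
have /cf ft : `[0, 1]%classic t by rewrite /= in_itv.
by apply: (ft [set y | enorm (y - f t) < d]); apply/nbhs_enormP; exists d.
Qed.

(** Used both for the swept arc and for its complementary arc. A point [x] of [X s] outside [U] is
    at distance at least [d] from [X t], while [p s] and [q s] are within [d / 2] of it. So the part
    of [X s] within [d / 2] of [x] avoids [X t] and both endpoints, hence lies in the symmetric
    difference, whose length is then at least [d / 4]. *)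
Lemma sub_open_persists (U : set plane) (t : R) : 0 <= t <= 1 -> open U ->
  X t `<=` U -> \forall s \near t, 0 <= s <= 1 -> X s `<=` U.
Proof.
move=> t01 oU XU.
have [d d0 hd] := compact_open_gap (X_compact t01) oU XU.
have d2 : 0 < d / 2 by rewrite divr_gt0.
have [Xp Xq] := X_ends t01.
suff : \forall s \near within `[0, 1] (nbhs t), X s `<=` U.
  move=> XsU; have : \forall s \near t, `[0, 1]%classic s -> X s `<=` U := XsU.
  by apply: filterS => s h s01; apply: h; rewrite /= in_itv.
have np := near_end p_cont t01 d2.
have nq := near_end q_cont t01 d2.
have nl : \forall s \near within `[0, 1] (nbhs t),
    (length (C s `+` C t) < (d / 2 / 2)%:E)%E.
  apply: (@C_cont t t01 [set l | (l < (d / 2 / 2)%:E)%E]).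
  apply: open_nbhs_nbhs; split.
    exact: open_ereal_lt_ereal.
  by rewrite /= lte_fin divr_gt0.
have n01 : \forall s \near within `[0, 1] (nbhs t), 0 <= s <= 1.
  by near=> s; have : s \in `[0, 1] by near: s; exact: withinT.
near=> s => x Xx; apply: contrapT => nUx.
have s01 : 0 <= s <= 1 by near: s.
have [Xps Xqs] := X_ends s01.
have far f : X t (f t) -> enorm (f s - f t) < d / 2 -> d / 2 <= enorm (f s - x).
  move=> Xf fst; rewrite leNgt; apply/negP => fx; apply: nUx.
  apply: (hd x (f t)) => //; apply: le_lt_trans (ler_enorm_dist x (f s) (f t)) _.
  rewrite (enormBC x); lra.
have fp : d / 2 <= enorm (p s - x) by apply: far => //; near: s.
have fq : d / 2 <= enorm (q s - x) by apply: far => //; near: s.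
have : ((d / 2 / 2)%:E <= length (C s `+` C t))%E.
  apply: (connected_escape_length d2 (X_connected s01) Xx Xps fp) => y Xy yx.
  have nXy : ~ X t y.
    move=> Xty; apply: nUx; apply: (hd x y) => //; rewrite enormBC; lra.
  have [//|[yE|yE]] := X_sub s01 t01 (conj Xy nXy).
    by move: yx; rewrite yE ltNge fp.
  by move: yx; rewrite yE ltNge fq.
by rewrite leNgt => /negP; apply; near: s.
Unshelve. all: by end_near. Qed.

End Persistence.

Variable Omega : set plane.
Hypothesis Omega_compact : compact Omega.
Hypothesis Omega_convex : convex_set Omega.
Hypothesis Omega_domain : interior Omega !=set0.
Local Notation Gamma := (boundary Omega).

Lemma short_arc_visible (p q : plane) (A : set plane) :
  closed_arc Gamma p q A -> enorm (p - q) < min_width Gamma ->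
  (exists v, A `<=` visible Omega v) \/
  (exists v, (Gamma `\` A) `|` [set p; q] `<=` visible Omega v).
Proof.
move=> [c [a [b [cJ ab <- <- ->]]]] short.
rewrite -(arc_complement cJ ab).
rewrite enormBC in short.
have [z Iz Izd] := interior_chord Omega_compact Omega_convex Omega_domain short.
pose v := z - c a.
have Ia : interior Omega (c a + v) by rewrite /v addrC subrK.
have Ib : interior Omega (c b + v) by rewrite /v addrCA.
(* Coinciding endpoints mean [b = a] or [b = a + 1]: one of the two arcs is a single point. *)
have [cab|cab] := pselect (c a = c b); last first.
  by have [h|h] := visible_arc Omega_compact Omega_convex cJ ab cab Ia Ib;
    [left|right]; exists v.
have Va : visible Omega v (c a) by exists 1; rewrite ?scale1r.
have /andP[ab1 ab2] := ab.
have [ba|ba] := eqVneq a b.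
  left; exists v => _ [t + <-]; rewrite /= in_itv/= -ba => t1.
  by have -> : t = a by apply: le_anti; rewrite andbC.
right; exists v => _ [t + <-]; rewrite /= in_itv/= => /andP[t1 t2].
have [ba'|ba'] := eqVneq b (a + 1).
  have -> : t = b by apply: le_anti; rewrite t1 ba' t2.
  by rewrite -cab.
exfalso; apply: (jordan_inj cJ _ cab); rewrite !lt_def ab1 ab2 !andbT.
by rewrite eq_sym ba eq_sym ba'.
Qed.

Lemma sweepout_wide (p q : R -> plane) (C : R -> set plane) :
  is_sweepout Gamma p q C ->
  exists2 t : R, 0 <= t <= 1 & min_width Gamma <= enorm (p t - q t).
Proof.
move=> [Gpq [_ _] [cp cq] [arcC contC] [C0 C1]].
apply: contrapT => narrow.
have short t : 0 <= t <= 1 -> enorm (p t - q t) < min_width Gamma.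
  by move=> t01; rewrite ltNge; apply/negP => h; apply: narrow; exists t.
pose D t := (Gamma `\` C t) `|` [set p t; q t].
pose S t := exists v, C t `<=` visible Omega v.
pose L t := exists v, D t `<=` visible Omega v.
have SL t : 0 <= t <= 1 -> S t \/ L t.
  by move=> t01; exact: short_arc_visible (arcC t t01) (short t t01).
have nSL t : S t -> L t -> False.
  move=> [v hv] [w hw].
  apply: (boundary_not_visible2 Omega_compact Omega_domain (v := v) (w := w)) => x Gx.
  by have [Cx|Cx] := pselect (C t x); [left; exact: hv|right; apply: hw; left].
have S_open t : 0 <= t <= 1 -> S t -> \forall s \near t, 0 <= s <= 1 -> S s.
  move=> t01 [v hv].
  have : \forall s \near t, 0 <= s <= 1 -> C s `<=` visible Omega v.
    apply: (sub_open_persists cp cq contC (X := C)) => //.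
    - by move=> s /arcC [c [a [b [cJ _ _ _ ->]]]]; exact: arc_compact cJ _ _.
    - move=> s /arcC [c [a [b [cJ _ _ _ ->]]]]; apply: (arc_connected cJ).
      exact: interval_is_interval.
    - move=> s /arcC [c [a [b [cJ /andP[ab _] <- <- ->]]]].
      by split; [exists a|exists b] => //=; rewrite in_itv/= ab lexx.
    - by move=> s u _ _ x [Csx Cux]; left; left.
    - exact: open_visible.
  by apply: filterS => s h s01; exists v; exact: h.
have L_open t : 0 <= t <= 1 -> L t -> \forall s \near t, 0 <= s <= 1 -> L s.
  move=> t01 [v hv].
  have : \forall s \near t, 0 <= s <= 1 -> D s `<=` visible Omega v.
    apply: (sub_open_persists cp cq contC (X := D)) => //.
    - move=> s /arcC [c [a [b [cJ ab pE qE CE]]]].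
      by rewrite /D CE -pE -qE -(arc_complement cJ ab); exact: arc_compact cJ _ _.
    - move=> s /arcC [c [a [b [cJ ab pE qE CE]]]].
      rewrite /D CE -pE -qE -(arc_complement cJ ab); apply: (arc_connected cJ).
      exact: interval_is_interval.
    - by move=> s _; split; right; [left|right].
    - move=> s u _ _ x [[[Gx Csx]|xpq] Dux]; last by right.
      left; right; split=> //; apply: contrapT => Cux.
      by apply: Dux; left.
    - exact: open_visible.
  by apply: filterS => s h s01; exists v; exact: h.
have i01 (t : R) : `[0, 1]%classic t <-> 0 <= t <= 1 by rewrite /= in_itv.
have S0 : S 0.
  have [z Iz] := Omega_domain; exists (z - p 0) => x; rewrite C0 => ->.
  by exists 1; rewrite // scale1r addrC subrK.
have nS1 : ~ S 1.
  rewrite /S C1 => -[v hv].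
  apply: (boundary_not_visible2 Omega_compact Omega_domain (v := v) (w := v)) => x Gx.
  by left; exact: hv.
apply: nS1.
suff : `[0, 1]%classic `&` [set t | S t] = `[0, 1]%classic.
  by move=> /seteqP[_ /(_ 1)] []//=; rewrite in_itv/= ler01 lexx.
apply: (@segment_connected R 0 1).
- by exists 0; split=> //=; rewrite in_itv/= ler01 lexx.
- exists (interior [set s | 0 <= s <= 1 -> S s]); first exact: open_interior.
  apply/seteqP; split=> t [/[dup] t01 /i01 t01' h]; split=> //.
    exact: S_open.
  exact: (interior_subset h).
(* Within [[0, 1]], [S] is the negation of [L], so the openness of [L] makes [S] closed. *)
- exists (~` interior [set s | 0 <= s <= 1 -> L s]).
    by apply: open_closedC; exact: open_interior.
  apply/seteqP; split=> t [/[dup] t01 /i01 t01' h]; split=> //.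
    by move=> /interior_subset /(_ t01'); exact: nSL.
  by have [//|/(L_open t t01')] := SL t t01'.
Qed.

End LowerBound.

(** * Matching of monotone functions, angles *)

Lemma lipschitz_within_continuous (R : realType) (V : normedModType R)
    (f : R -> V) (K : R) (A : set R) :
  (forall s t, A s -> A t -> `|f s - f t| <= K * `|s - t|) ->
  {within A, continuous f}.
Proof.
move=> fK; apply/subspace_continuousP => t At.
apply/cvgrPdist_lt => e e0.
have K1 : 0 < `|K| + 1 by have := normr_ge0 K; lra.
have h : \forall s \near t, A s -> `|f t - f s| < e.
  near=> s => As; apply: le_lt_trans (fK _ _ At As) _.
  apply: (@le_lt_trans _ _ ((`|K| + 1) * `|t - s|)).
    by rewrite ler_wpM2r//; have := ler_norm K; lra.
  rewrite mulrC -ltr_pdivlMr//; near: s.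
  by apply: (@cvgr_dist_lt _ _ _ (nbhs t) _ id t) => //; rewrite divr_gt0.
exact: h.
Unshelve. all: by end_near. Qed.

Section Matching.
Context (R : realType).
Variables (g1 g2 : R -> R) (L1 L2 : R).
Hypothesis g1_cont : continuous g1.
Hypothesis g2_cont : continuous g2.
Hypothesis L1_ge0 : 0 <= L1.
Hypothesis L2_ge0 : 0 <= L2.
Hypothesis g1_decr : forall s t, 0 <= s -> s < t -> t <= L1 -> g1 t < g1 s.
Hypothesis g2_decr : forall s t, 0 <= s -> s < t -> t <= L2 -> g2 t < g2 s.
Hypothesis g_start : g1 0 = g2 0.
Hypothesis g_end : g1 L1 = g2 L2.

(** Taking the sum [a t + b t] as parameter leaves one unknown, found by the intermediate value
    theorem. Strict decrease forces [a] and [b] to be monotone: if one went back, the other would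
    advance, and the two values would move apart. *)
Lemma decreasing_matching : exists a b : R -> R,
  (forall t, 0 <= t <= L1 + L2 ->
    [/\ 0 <= a t <= L1, 0 <= b t <= L2, a t + b t = t & g1 (a t) = g2 (b t)]) /\
  (forall s t, 0 <= s -> s <= t -> t <= L1 + L2 -> a s <= a t /\ b s <= b t).
Proof.
have g1_le s t : 0 <= s -> s <= t -> t <= L1 -> g1 t <= g1 s.
  by move=> s0; rewrite le_eqVlt => /orP[/eqP->//|st tL]; exact/ltW/g1_decr.
have g2_le s t : 0 <= s -> s <= t -> t <= L2 -> g2 t <= g2 s.
  by move=> s0; rewrite le_eqVlt => /orP[/eqP->//|st tL]; exact/ltW/g2_decr.
have ex t : exists x, 0 <= t <= L1 + L2 ->
    [/\ 0 <= x <= L1, 0 <= t - x <= L2 & g1 x = g2 (t - x)].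
  have [/andP[t0 tL]|nt] := boolP (0 <= t <= L1 + L2); last by exists 0.
  pose lo := Num.max 0 (t - L2); pose hi := Num.min t L1.
  have lohi : lo <= hi.
    by rewrite ge_max !le_min t0 L1_ge0 gerBl L2_ge0 lerBlDr.
  have lo0 : 0 <= lo by rewrite le_max lexx.
  have lo1 : t - L2 <= lo by rewrite le_max lexx orbT.
  have hi0 : hi <= t by rewrite ge_min lexx.
  have hi1 : hi <= L1 by rewrite ge_min lexx orbT.
  pose G x := g1 x - g2 (t - x).
  have cG : continuous G.
    move=> x; apply: cvgB; first exact: g1_cont.
    apply: (continuous_comp (f := fun x => t - x)); last exact: g2_cont.
    by apply: cvgB; [exact: cvg_cst|exact: cvg_id].
  (* At [lo] either [x = 0] or [t - x = L2], at [hi] either [x = t] or [x = L1]: one of the two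
     functions is at a common end value. *)
  have Glo : 0 <= G lo.
    rewrite /G subr_ge0 /lo; case: (leP 0 (t - L2)) => h.
      rewrite opprB addrC subrK -g_end.
      by apply: g1_le => //; lra.
    by rewrite subr0 g_start; apply: g2_le => //; lra.
  have Ghi : G hi <= 0.
    rewrite /G subr_le0 /hi; case: (leP t L1) => h.
      by rewrite subrr -g_start; apply: g1_le.
    by rewrite g_end; apply: g2_le; lra.
  have [|x + Gx] := IVT lohi (continuous_subspaceT cG) (v := 0).
    by rewrite ge_min le_max Glo Ghi orbT.
  rewrite in_itv/= => /andP[x1 x2]; exists x => _.
  split; [by apply/andP; split; lra|by apply/andP; split; lra|].
  exact: subr0_eq.
have [a ha] := choice ex.
exists a, (fun t => t - a t); split.
  by move=> t /ha [h1 h2 h3]; split=> //; ring.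
move=> s t s0 st tL.
have s01 : 0 <= s <= L1 + L2 by rewrite s0 (le_trans st).
have t01 : 0 <= t <= L1 + L2 by rewrite tL (le_trans s0).
have [/andP[a1 a2] /andP[a3 a4] a5] := ha _ s01.
have [/andP[b1 b2] /andP[b3 b4] b5] := ha _ t01.
split; rewrite leNgt; apply/negP => h.
  have : g1 (a s) < g1 (a t) by exact: g1_decr.
  rewrite a5 b5 ltNge => /negP; apply; apply: g2_le => //; lra.
have : g2 (s - a s) < g2 (t - a t) by exact: g2_decr.
rewrite -a5 -b5 ltNge => /negP; apply; apply: g1_le => //; lra.
Qed.

End Matching.

(** * The unit circle parametrized by turns *)

Section Circle.
Context (R : realType).
Local Notation plane := 'rV[R]_2.

Lemma sin_lipschitz (x y : R) : `|sin x - sin y| <= `|x - y|.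
Proof.
wlog xy : x y / x < y.
  move=> h; have [xy|yx|->] := ltgtP x y; first exact: h.
    by rewrite distrC [leRHS]distrC; exact: h.
  by rewrite !subrr.
have [c _ ->] : exists2 c, c \in `]x, y[ & sin x - sin y = - cos c * (y - x).
  have [c cxy h] := @MVT R sin cos x y xy (fun z _ => is_derive_sin z)
    (continuous_subspaceT (@continuous_sin R)).
  by exists c => //; rewrite mulNr -h opprB.
rewrite normrM normrN distrC ler_piMl//; exact: cos_max.
Qed.

Lemma cos_lipschitz (x y : R) : `|cos x - cos y| <= `|x - y|.
Proof.
by rewrite -!sinDpihalf; apply: le_trans (sin_lipschitz _ _) _;
  rewrite opprD addrACA subrr addr0.
Qed.

(** Angles are counted in full turns, so that the period is 1 as in [jordan_parametrization]. *)
Definition turn (t : R) : R := t * (pi *+ 2).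

Let turnE t : turn t = t * 2 * pi.
Proof. by rewrite /turn -mulr_natr; ring. Qed.

Lemma turn_int (t : R) (k : int) :
  cos (turn (t + k%:~R)) = cos (turn t) /\ sin (turn (t + k%:~R)) = sin (turn t).
Proof.
have nat_case (s : R) (n : nat) :
    cos (turn (s + n%:R)) = cos (turn s) /\ sin (turn (s + n%:R)) = sin (turn s).
  rewrite /turn mulrDl mulr_natl.
  by split; [exact: periodicn (@cosD2pi R) _ _|exact: periodicn (@sinD2pi R) _ _].
case: k => n; first exact: nat_case.
rewrite NegzE rmorphN /=.
by have [<- <-] := nat_case (t - n.+1%:R) n.+1; rewrite subrK.
Qed.

(** After reduction to a fractional part in []0, 1[], the upper half is folded onto the lower one by
    parity; there the angle lies in [[0, pi]], where [cos] is injective. *)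
Lemma cos_turn_eq1 (t : R) : cos (turn t) = 1 -> exists k : int, t = k%:~R.
Proof.
have /andP[h1 h2] := floor_itv t.
set k := Num.floor t in h1 h2 *.
have := (turn_int (t - k%:~R) k).1; rewrite subrK => -> c1.
exists k; apply/eqP; rewrite -subr_eq0; apply/negPn/negP => s0.
have {}h2 : t - k%:~R < 1 by move: h2; rewrite rmorphD /=; lra.
have {h1 s0}h1 : 0 < t - k%:~R by rewrite lt_def s0 subr_ge0.
set s := t - _ in c1 h1 h2.
have p0 := pi_gt0 R.
have key (r : R) : 0 < r -> r <= 2^-1 -> cos (turn r) <> 1.
  move=> r0 r1; rewrite -[1]cos0 => /cos_inj.
  rewrite !in_itv/= lexx pi_ge0 turnE => h.
  have : r * 2 * pi = 0.
    apply: h => //; rewrite mulr_ge0 ?(ltW p0)//=; last lra.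
    by rewrite ler_piMl ?(ltW p0)//; lra.
  by have := mulr_gt0 (mulr_gt0 r0 (ltr0n _ 2)) p0; lra.
have [sh|sh] := leP s 2^-1; first exact: key c1.
apply: (@key (1 - s)); [lra|lra|].
apply: etrans c1; rewrite -cosN -(turn_int s (-1)).1; congr cos.
by rewrite !turnE mulrN1z; ring.
Qed.

Lemma circle_angle (a b : R) : a ^+ 2 + b ^+ 2 = 1 ->
  exists t, cos (turn t) = a /\ sin (turn t) = b.
Proof.
move=> ab.
have p0 : pi *+ 2 != 0 :> R by rewrite mulrn_eq0 negb_or /= gt_eqF// pi_gt0.
have a1 : -1 <= a <= 1.
  rewrite -ler_norml -(@expr_le1 _ 2)// real_normK ?num_real//.
  by have := sqr_ge0 b; lra.
have sq : Num.sqrt (1 - a ^+ 2) = `|b|.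
  by rewrite (_ : 1 - a ^+ 2 = b ^+ 2) ?sqrtr_sqr//; lra.
have [b0|b0] := leP 0 b.
  exists (acos a / (pi *+ 2)); rewrite /turn divfK// acosK ?in_itv//.
  by rewrite sin_acos// sq ger0_norm.
exists (- acos a / (pi *+ 2)); rewrite /turn divfK// cosN sinN acosK ?in_itv//.
by rewrite sin_acos// sq ltr0_norm// opprK.
Qed.

Lemma sin_turn_gt0 (t : R) : 0 < t < 2^-1 -> 0 < sin (turn t).
Proof.
move=> /andP[t0 t1]; have p0 := pi_gt0 R; apply: sin_gt0_pi.
rewrite turnE mulr_gt0//=; last lra.
by rewrite gtr_pMl//; lra.
Qed.

Lemma cos_turn_ge0 (t : R) : - 4^-1 <= t <= 4^-1 -> 0 <= cos (turn t).
Proof.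
move=> /andP[t0 t1]; have p0 := pi_gt0 R; apply: cos_ge0_pihalf.
by rewrite turnE; apply/andP; split; nra.
Qed.

Lemma cos_turn_le0 (t : R) : 4^-1 <= t <= 3 / 4 -> cos (turn t) <= 0.
Proof.
move=> /andP[t0 t1].
have : 0 <= cos (turn (t - 2^-1)) by apply: cos_turn_ge0; apply/andP; split; lra.
have -> : turn (t - 2^-1) = turn t - pi by rewrite !turnE; field.
by rewrite cosB cospi sinpi; lra.
Qed.

Definition circle_point (u : plane) (t : R) : plane :=
  cos (turn t) *: u + sin (turn t) *: perp u.

Variable u : plane.
Hypothesis u1 : enorm u = 1.
Local Notation e := (circle_point u).

Let uu : dotp u u = 1.
Proof. by rewrite -enorm_sqr u1 expr1n. Qed.

Let uperp : dotp (perp u) (perp u) = 1.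
Proof. by rewrite -enorm_sqr enorm_perp u1 expr1n. Qed.

Lemma dotp_circle_point t : dotp (e t) u = cos (turn t).
Proof. by rewrite dotpDl !dotpZl uu dotp_perp mulr0 addr0 mulr1. Qed.

Lemma dotp_circle_point_perp t : dotp (e t) (perp u) = sin (turn t).
Proof. by rewrite dotpDl !dotpZl uperp (dotpC u) dotp_perp mulr0 add0r mulr1. Qed.

Lemma enorm_circle_point t : enorm (e t) = 1.
Proof.
rewrite /enorm {2}/circle_point dotpDr !dotpZr dotp_circle_point.
by rewrite dotp_circle_point_perp -!expr2 cos2Dsin2 sqrtr1.
Qed.

Lemma circle_point_neq0 t : e t != 0.
Proof.
apply/eqP => /(congr1 (@enorm R)); rewrite enorm_circle_point enorm0.
by move/eqP; rewrite oner_eq0.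
Qed.

Lemma circle_point_int t (k : int) : e (t + k%:~R) = e t.
Proof. by rewrite /circle_point; have [-> ->] := turn_int t k. Qed.

Lemma circle_point_inj s t : e s = e t -> exists k : int, t = s + k%:~R.
Proof.
move=> est; have : cos (turn (t - s)) = 1.
  rewrite /turn mulrBl cosB -/(turn _) -/(turn s) -!dotp_circle_point.
  rewrite -!dotp_circle_point_perp est dotp_circle_point dotp_circle_point_perp.
  by rewrite -!expr2 cos2Dsin2.
by move=> /cos_turn_eq1 [k kE]; exists k; rewrite -kE addrC subrK.
Qed.

Lemma circle_point_surj (x : plane) : x != 0 -> exists t, x = enorm x *: e t.
Proof.
move=> x0; have nx := enorm_gt0 x0.
have xE := perp_decomposition u x; rewrite uu scale1r in xE.
have [|t [ct st]] := @circle_angle (dotp x u / enorm x) (dotp x (perp u) / enorm x).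
  rewrite !exprMn -mulrDl exprVn.
  rewrite (_ : _ + _ = enorm x ^+ 2) ?divff ?expf_eq0 ?gt_eqF//.
  by rewrite enorm_sqr -dotp_pythagoras uu mul1r.
exists t; rewrite /circle_point ct st scalerDr !scalerA.
by rewrite ![enorm x * _]mulrC !divfK ?gt_eqF.
Qed.

(** For [s1 < s < s2] spanning less than half a turn the three sines are positive: [e s] lies in the
    cone spanned by [e s1] and [e s2]. *)
Lemma circle_point_sector s1 s s2 :
  sin (turn (s2 - s1)) *: e s =
  sin (turn (s2 - s)) *: e s1 + sin (turn (s - s1)) *: e s2.
Proof.
rewrite /turn !mulrBl !sinB -!/(turn _) /circle_point.
by apply: plane_eq; rewrite !mxE /=; ring.
Qed.

Lemma circle_point_lipschitz s t : enorm (e s - e t) <= pi *+ 4 * `|s - t|.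
Proof.
have -> : e s - e t = (cos (turn s) - cos (turn t)) *: u +
                      (sin (turn s) - sin (turn t)) *: perp u.
  by rewrite /circle_point; apply: plane_eq; rewrite !mxE /=; ring.
apply: le_trans (ler_enormD _ _) _; rewrite !enormZ enorm_perp u1 !mulr1.
have h : `|turn s - turn t| = pi *+ 2 * `|s - t|.
  rewrite /turn -mulrBl normrM mulrC; congr (_ * _).
  by rewrite ger0_norm// mulrn_wge0// pi_ge0.
apply: le_trans (lerD (cos_lipschitz _ _) (sin_lipschitz _ _)) _.
by rewrite h -mulrDl -mulrnDr.
Qed.

End Circle.

(** * Radial parametrization of the boundary *)

Section RadialCurve.
Context (R : realType).
Local Notation plane := 'rV[R]_2.
Variable Omega : set plane.
Hypothesis Omega_compact : compact Omega.
Hypothesis Omega_convex : convex_set Omega.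
Variable z : plane.
Hypothesis Iz : interior Omega z.

Let Oz : Omega z.
Proof. exact: interior_subset Iz. Qed.

(** [rho] is taken on all nonzero vectors, not only unit ones, so that the gauge can be evaluated at
    differences of unit vectors. *)
Lemma radial_function_exists : exists rho : plane -> R, forall x, x != 0 ->
  0 < rho x /\ boundary Omega (z + rho x *: x).
Proof.
suff /choice[rho h] : forall x, exists r : R, x != 0 ->
    0 < r /\ boundary Omega (z + r *: x) by exists rho.
move=> x; have [->|x0] := eqVneq x 0; first by exists 0.
have [s s0 Gs] := boundary_ray Omega_compact Oz x0; exists s => _; split=> //.
rewrite lt_def s0 andbT; apply/eqP => s00.
by move: Gs; rewrite s00 scale0r addr0 => -[].
Qed.

Variable rho : plane -> R.
Hypothesis rhoP : forall x, x != 0 -> 0 < rho x /\ boundary Omega (z + rho x *: x).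

Lemma rho_gt0 x : x != 0 -> 0 < rho x.
Proof. by move=> /rhoP[]. Qed.

Lemma rho_max x s : x != 0 -> Omega (z + s *: x) -> s <= rho x.
Proof.
move=> x0 Os; rewrite leNgt; apply/negP => rs.
have [r0 Gr] := rhoP x0.
suff : interior Omega (z + rho x *: x) by move=> Ir; case: Gr.
have s0 : 0 < s by exact: lt_trans rs.
have -> : z + rho x *: x = (1 - rho x / s) *: z +
    (1 - (1 - rho x / s)) *: (z + s *: x).
  by apply: plane_eq; rewrite !mxE; field; rewrite gt_eqF.
apply: (interior_conv Omega_convex Iz Os).
have h : 0 < rho x / s by rewrite divr_gt0.
have h1 : rho x / s < 1 by rewrite ltr_pdivrMr// mul1r.
by apply/andP; split; lra.
Qed.

Lemma rho_unique x s : x != 0 -> 0 < s -> boundary Omega (z + s *: x) ->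
  s = rho x.
Proof.
move=> x0 s0 Gs; apply: le_anti; rewrite rho_max//=; last first.
  exact: (boundary_sub Omega_compact).
rewrite leNgt; apply/negP => sr.
have [r0 Gr] := rhoP x0.
suff : interior Omega (z + s *: x) by move=> Ir; case: Gs.
have -> : z + s *: x = (1 - s / rho x) *: z +
    (1 - (1 - s / rho x)) *: (z + rho x *: x).
  by apply: plane_eq; rewrite !mxE; field; rewrite gt_eqF.
apply: (interior_conv Omega_convex Iz); first exact: (boundary_sub Omega_compact).
have h : 0 < s / rho x by rewrite divr_gt0.
have h1 : s / rho x < 1 by rewrite ltr_pdivrMr// mul1r.
by apply/andP; split; lra.
Qed.

(* [1 / rho] is the Minkowski gauge of [Omega] centred at [z]: this is its
   subadditivity. *)
Lemma rho_sublinear (w x y : plane) (D a b : R) :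
  w != 0 -> x != 0 -> y != 0 -> 0 < D -> 0 < a -> 0 < b ->
  D *: w = a *: x + b *: y -> D / rho w <= a / rho x + b / rho y.
Proof.
move=> w0 x0 y0 D0 a0 b0 wE.
have [rx0 /(boundary_sub Omega_compact) Ox] := rhoP x0.
have [ry0 /(boundary_sub Omega_compact) Oy] := rhoP y0.
have rw0 := rho_gt0 w0.
have ax : 0 < a / rho x by rewrite divr_gt0.
have bY : 0 < b / rho y by rewrite divr_gt0.
set G := a / rho x + b / rho y.
have G0 : 0 < G by rewrite addr_gt0.
suff : D / G <= rho w by rewrite ler_pdivrMr// ler_pdivrMr// mulrC.
apply: rho_max => //.
pose l := a / rho x / G.
have -> : z + (D / G) *: w =
    l *: (z + rho x *: x) + (1 - l) *: (z + rho y *: y).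
  have -> : 1 - l = b / rho y / G.
    by rewrite -(divff (lt0r_neq0 G0)) /l -mulrBl /G addrC addKr.
  rewrite mulrC -scalerA wE !scalerDr !scalerA addrACA -scalerDl.
  rewrite /l -mulrDl -/G divff ?gt_eqF// scale1r.
  congr (_ + (_ *: _ + _ *: _)); field; by rewrite !gt_eqF.
apply: (convex_body_conv Omega_convex Ox Oy).
apply/andP; split; first by rewrite ltW// divr_gt0.
by rewrite ler_pdivrMr// mul1r /G; lra.
Qed.

Lemma rho_le : exists2 M : R, 0 < M & forall x, enorm x = 1 -> rho x <= M.
Proof.
have [M M0 hM] := convex_body_bounded Omega_compact.
exists (M + M) => [|x x1]; first lra.
have x0 : x != 0.
  by apply/eqP => x0; move: x1; rewrite x0 enorm0; lra.
have [r0 /(boundary_sub Omega_compact)/hM h] := rhoP x0.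
have := hM z Oz; have := ler_enormD (z + rho x *: x) (- z).
rewrite addrAC subrr add0r enormZ x1 mulr1 gtr0_norm// enormN; lra.
Qed.

(** Subadditivity of the gauge bounds [1 / rho x - 1 / rho y] by [1 / rho (x - y)], and a ball of
    radius [r] about [z] bounds the latter by [2 / r * enorm (x - y)]. Passing from [1 / rho] to
    [rho] costs the factor [M * M]. *)
Lemma rho_lipschitz : exists2 K : R, 0 < K &
  forall x y, enorm x = 1 -> enorm y = 1 ->
  `|rho x - rho y| <= K * enorm (x - y).
Proof.
have [M M0 hM] := rho_le.
have /nbhs_enormP[r r0 hr] := Iz.
exists (M * M * (2 / r)).
  by rewrite !mulr_gt0 ?invr_gt0.
have nz x : enorm x = 1 -> x != 0 :> plane.
  by move=> x1; apply/eqP => x0; move: x1; rewrite x0 enorm0; lra.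
suff one x y : enorm x = 1 -> enorm y = 1 ->
    rho y - rho x <= M * M * (2 / r) * enorm (x - y).
  move=> x y x1 y1; have := one x y x1 y1; have := one y x y1 x1.
  by rewrite (enormBC y) ler_norml => h1 h2; apply/andP; split; lra.
move=> x1 y1.
have [->|xy] := eqVneq x y; first by rewrite !subrr enorm0 mulr0.
have d0 : x - y != 0 by rewrite subr_eq0.
have nd := enorm_gt0 d0.
have rx0 := rho_gt0 (nz x x1).
have ry0 := rho_gt0 (nz y y1).
have rd0 := rho_gt0 d0.
have rd : r / 2 / enorm (x - y) <= rho (x - y).
  apply: rho_max => //; apply: hr.
  rewrite addrAC subrr add0r enormZ ger0_norm ?divfK ?gt_eqF//; first lra.
  by rewrite !divr_ge0// ltW.
have := @rho_sublinear x y (x - y) 1 1 1 (nz x x1) (nz y y1) d0 ltr01 ltr01 ltr01.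
rewrite !scale1r addrCA subrr addr0 => /(_ erefl) h.
have h2 : 1 / rho (x - y) <= 2 / r * enorm (x - y).
  rewrite ler_pdivrMr//.
  apply: le_trans (_ : 2 / r * enorm (x - y) * (r / 2 / enorm (x - y)) <= _).
    have nd' : enorm (x - y) != 0 by rewrite gt_eqF.
    have r0' : r != 0 by rewrite gt_eqF.
    have -> : 2 / r * enorm (x - y) * (r / 2 / enorm (x - y)) = 1.
      by field; apply/andP.
    by [].
  by rewrite ler_wpM2l// mulr_ge0 ?divr_ge0 ?ltW.
have -> : rho y - rho x = rho x * rho y * (1 / rho x - 1 / rho y).
  by field; rewrite !gt_eqF.
rewrite -[leRHS]mulrA.
have le1 : 1 / rho x - 1 / rho y <= 2 / r * enorm (x - y) by lra.
have p0 : 0 <= 2 / r * enorm (x - y) by rewrite mulr_ge0 ?divr_ge0 ?ltW.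
apply: le_trans (_ : rho x * rho y * (2 / r * enorm (x - y)) <= _).
  by rewrite ler_wpM2l// mulr_ge0// ltW.
by rewrite ler_wpM2r// ler_pM ?hM// ltW.
Qed.

Variable u : plane.
Hypothesis u1 : enorm u = 1.
Local Notation e := (circle_point u).

Definition radial_curve (t : R) : plane := z + rho (e t) *: e t.

Lemma radial_curve_lipschitz : exists2 K : R, 0 < K &
  forall s t, enorm (radial_curve s - radial_curve t) <= K * `|s - t|.
Proof.
have [M M0 hM] := rho_le.
have [K K0 hK] := rho_lipschitz.
have p0 : 0 < pi *+ 4 :> R by rewrite mulrn_wgt0// pi_gt0.
exists ((M + K) * (pi *+ 4)); first by rewrite mulr_gt0// addr_gt0.
move=> s t; have es1 := enorm_circle_point u1 s; have et1 := enorm_circle_point u1 t.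
have -> : radial_curve s - radial_curve t =
    rho (e s) *: (e s - e t) + (rho (e s) - rho (e t)) *: e t.
  by rewrite /radial_curve; apply: plane_eq; rewrite !mxE; ring.
apply: le_trans (ler_enormD _ _) _; rewrite !enormZ et1 mulr1.
apply: (@le_trans _ _ ((M + K) * enorm (e s - e t))).
  rewrite mulrDl lerD ?hK// ler_wpM2r ?enorm_ge0//.
  by rewrite gtr0_norm ?rho_gt0 ?circle_point_neq0// hM.
rewrite -mulrA ler_wpM2l ?circle_point_lipschitz//; lra.
Qed.

Lemma radial_curve_jordan : jordan_parametrization (boundary Omega) radial_curve.
Proof.
have e0 := circle_point_neq0 u1.
split.
- by have [K _ hK] := radial_curve_lipschitz; exact: curve_lipschitz_continuous hK.
- move=> s t; split=> [/addrI est|[k ->]]; last first.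
    by rewrite /radial_curve circle_point_int.
  apply: (circle_point_inj u1).
  have := congr1 (@enorm R) est.
  rewrite !enormZ !gtr0_norm ?rho_gt0// !enorm_circle_point// !mulr1 => rE.
  apply: (scalerI (lt0r_neq0 (rho_gt0 (e0 s)))).
  by rewrite est rE.
- apply/seteqP; split=> [_ [t _ <-]|x Gx]; first exact: (rhoP (e0 t)).2.
  have xz : x - z != 0.
    rewrite subr_eq0; apply/eqP => xz; case: Gx => _; apply.
    by rewrite xz.
  have [t tE] := circle_point_surj u1 xz; exists t => //.
  rewrite /radial_curve -(@rho_unique (e t) (enorm (x - z))) ?enorm_gt0//.
    by rewrite -tE addrC subrK.
  by rewrite -tE addrC subrK.
Qed.

Definition abscissa (t : R) : R := rho (e t) * cos (turn t).

Lemma dotp_radial_curve t : dotp (radial_curve t) u = dotp z u + abscissa t.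
Proof. by rewrite dotpDl dotpZl dotp_circle_point. Qed.

Lemma abscissa_continuous : continuous abscissa.
Proof.
have -> : abscissa = (fun t => dotp (radial_curve t - z) u).
  by apply/funext => t; rewrite dotpBl dotp_radial_curve addrC addKr.
move=> t; apply: (continuous_comp (f := radial_curve) (g := fun x => dotp (x - z) u)).
  by have [c _ _] := radial_curve_jordan; exact: c.
exact: continuous_dotpBl.
Qed.

Lemma abscissa_int t (k : int) : abscissa (t + k%:~R) = abscissa t.
Proof. by rewrite /abscissa circle_point_int; have [-> _] := turn_int t k. Qed.

(* Superlevel sets [{sg * abscissa >= k}] with [k >= 0] are sublevel sets of
   the convex positively homogeneous function [k / rho - sg * dotp _ u]. *)
Lemma abscissa_sector (sg k s1 s s2 : R) : 0 <= k ->
  s1 <= s <= s2 -> s2 - s1 < 2^-1 ->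
  k <= sg * abscissa s1 -> k <= sg * abscissa s2 -> k <= sg * abscissa s.
Proof.
move=> k0 /andP[]; rewrite le_eqVlt => /orP[/eqP<-//|s1s].
rewrite le_eqVlt => /orP[/eqP->//|ss2] s12 h1 h2.
have e0 := circle_point_neq0 u1.
have r0 t := rho_gt0 (e0 t).
set D := sin (turn (s2 - s1)); set a := sin (turn (s2 - s)).
set b := sin (turn (s - s1)).
have D0 : 0 < D by apply: sin_turn_gt0; apply/andP; split; lra.
have a0 : 0 < a by apply: sin_turn_gt0; apply/andP; split; lra.
have b0 : 0 < b by apply: sin_turn_gt0; apply/andP; split; lra.
have sE : D *: e s = a *: e s1 + b *: e s2 by exact: circle_point_sector.
have := rho_sublinear (e0 s) (e0 s1) (e0 s2) D0 a0 b0 sE => h.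
have cE := congr1 (fun x => dotp x u) sE.
rewrite /= dotpDl !dotpZl !dotp_circle_point// in cE.
have key t : k <= sg * abscissa t -> k / rho (e t) <= sg * cos (turn t).
  by move=> kt; rewrite ler_pdivrMr// -mulrA [cos _ * _]mulrC.
have k1 := key _ h1; have k2 := key _ h2.
rewrite /abscissa mulrCA -ler_pdivrMl// mulrC.
rewrite -(ler_pM2l D0) [leRHS]mulrCA cE mulrDr ![sg * (_ * _)]mulrCA.
apply: le_trans (_ : a * (k / rho (e s1)) + b * (k / rho (e s2)) <= _).
  by have := ler_wpM2l k0 h; rewrite mulrDr !(mulrCA k).
by apply: lerD; rewrite ler_wpM2l// ltW.
Qed.

(** The abscissa is nonnegative on [[-1/4, 1/4]] and nonpositive on [[1/4, 3/4]]. On each half,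
    [abscissa_sector] anchored at the extremum [t0] or [t1] gives monotonicity; the two halves are
    compared through the value 0. The extrema lie strictly inside the halves, since [z] is interior,
    which keeps the sectors below half a turn. *)
Lemma abscissa_bimonotone : exists t0 t1 : R, [/\ t0 < t1 < t0 + 1,
  forall s t, t0 <= s -> s <= t -> t <= t1 -> abscissa t <= abscissa s &
  forall s t, t1 - 1 <= s -> s <= t -> t <= t0 -> abscissa s <= abscissa t].
Proof.
have r0 t := rho_gt0 (circle_point_neq0 u1 t).
have [t0 + max0] := @EVT_max R abscissa (- 2^-1) 2^-1 ltac:(lra)
  (continuous_subspaceT abscissa_continuous).
rewrite in_itv/= => /andP[a1 a2].
have [t1 + min1] := @EVT_min R abscissa 0 1 ltac:(lra)
  (continuous_subspaceT abscissa_continuous).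
rewrite in_itv/= => /andP[b1 b2].
have {}max0 t : - 2^-1 <= t -> t <= 2^-1 -> abscissa t <= abscissa t0.
  by move=> h1 h2; apply: max0; rewrite in_itv/= h1.
have {}min1 t : 0 <= t -> t <= 1 -> abscissa t1 <= abscissa t.
  by move=> h1 h2; apply: min1; rewrite in_itv/= h1.
have X_ge0 t : - 4^-1 <= t -> t <= 4^-1 -> 0 <= abscissa t.
  by move=> h1 h2; rewrite mulr_ge0 ?(ltW (r0 _))// cos_turn_ge0// h1.
have X_le0 t : 4^-1 <= t -> t <= 3 / 4 -> abscissa t <= 0.
  by move=> h1 h2; rewrite mulr_ge0_le0 ?(ltW (r0 _))// cos_turn_le0// h1.
have X1 t : abscissa (t + 1) = abscissa t by exact: (abscissa_int t 1).
have p0 := pi_gt0 R.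
have X0_gt0 : 0 < abscissa t0.
  apply: lt_le_trans (max0 0 _ _); [|lra|lra].
  by rewrite /abscissa /turn mul0r cos0 mulr1.
have X1_lt0 : abscissa t1 < 0.
  apply: le_lt_trans (min1 2^-1 _ _) _; [lra|lra|].
  rewrite /abscissa pmulr_rlt0 ?r0// (_ : turn _ = pi) ?cospi ?ltrN10//.
  by rewrite /turn -mulr_natr; field.
have t0_lt : t0 < 4^-1.
  by rewrite ltNge; apply/negP => h; have := X_le0 t0 h ltac:(lra); lra.
have t0_gt : - 4^-1 < t0.
  by rewrite ltNge; apply/negP => h; have := X_le0 (t0 + 1) ltac:(lra) ltac:(lra); rewrite X1; lra.
have t1_gt : 4^-1 < t1.
  by rewrite ltNge; apply/negP => h; have := X_ge0 t1 ltac:(lra) h; lra.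
have t1_lt : t1 < 3 / 4.
  by rewrite ltNge; apply/negP => h; have := X_ge0 (t1 - 1) ltac:(lra) ltac:(lra);
    have := X1 (t1 - 1); rewrite subrK; lra.
exists t0, t1; split; first by apply/andP; split; lra.
- move=> s t h1 h2 h3.
  have [t4|t4] := leP t 4^-1.
    have := @abscissa_sector 1 (abscissa t) t0 s t.
    by rewrite !mul1r; apply; [apply: X_ge0; lra|rewrite h1| lra|apply: max0; lra|].
  have [s4|s4] := leP s 4^-1.
    by apply: (@le_trans _ _ 0); [apply: X_le0; lra|apply: X_ge0; lra].
  have := @abscissa_sector (-1) (- abscissa s) s t t1.
  rewrite !mulN1r !lerN2; apply; rewrite ?oppr_ge0 ?h2//; [apply: X_le0; lra|lra|].
  by apply: min1; lra.
- move=> s t h1 h2 h3.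
  have [s4|s4] := leP (- 4^-1) s.
    have := @abscissa_sector 1 (abscissa s) s t t0.
    by rewrite !mul1r; apply; [apply: X_ge0; lra|rewrite h2| lra| |apply: max0; lra].
  have [t4|t4] := leP (- 4^-1) t.
    apply: (@le_trans _ _ 0); last by apply: X_ge0; lra.
    by rewrite -X1; apply: X_le0; lra.
  (* A shift by one period brings both points into the half that contains [t1]. *)
  rewrite -(X1 s) -(X1 t).
  have := @abscissa_sector (-1) (- abscissa (t + 1)) t1 (s + 1) (t + 1).
  rewrite !mulN1r !lerN2; apply => //.
  + by rewrite oppr_ge0; apply: X_le0; lra.
  + by apply/andP; split; lra.
  + lra.
  + by apply: min1; lra.
Qed.

End RadialCurve.

(** * The upper bound *)

Lemma length_ge0 (R : realType) (A : set 'rV[R]_2) : (0 <= length A)%E.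
Proof.
apply: (@le_trans _ _ (length_at_scale 1 A)); last first.
  by apply: ereal_sup_ubound; exists 1 => /=.
by apply: le_ereal_inf_tmp => _ [U _ <-]; apply: nneseries_ge0 => *;
  exact: diameter_ge0.
Qed.

Section Upper.
Context (R : realType).
Local Notation plane := 'rV[R]_2.
Variable Omega : set plane.
Hypothesis Omega_compact : compact Omega.
Hypothesis Omega_convex : convex_set Omega.
Hypothesis Omega_domain : interior Omega !=set0.
Local Notation Gamma := (boundary Omega).

Lemma width_min_attained : exists2 theta, unit_circle R theta &
  width Gamma theta = min_width Gamma.
Proof.
have [M M0 hM] := convex_body_bounded Omega_compact.
have GM x : Gamma x -> enorm x <= M.
  by move=> Gx; apply: hM; exact: (boundary_sub Omega_compact).
have G0 : Gamma !=set0 by exact: boundary_nonempty.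
have cW : continuous (fun theta => width Gamma theta).
  apply: (@enorm_lipschitz_continuous _ _ (2 * M)); first lra.
  exact: width_lipschitz.
have cS : compact (unit_circle R).
  apply: bounded_closed_compact.
    exists 1; split; first exact: num_real.
    by move=> m m1 x /= x1; rewrite (le_trans (normr_le_enorm _))// x1 ltW.
  have -> : unit_circle R = (fun x => enorm (x - 0)) @^-1` [set 1].
    by apply/seteqP; split=> x; rewrite /unit_circle /= subr0.
  apply: preimage_closed; last exact: closed_eq.
  by move=> x _; exact: continuous_enormB.
have S0 : unit_circle R !=set0.
  exists ((enorm (const_mx 1 : plane))^-1 *: const_mx 1).
  have n0 := enorm_gt0 (plane_nonzero R).
  by rewrite /unit_circle /= enormZ gtr0_norm ?invr_gt0// mulVf ?gt_eqF.
have [t t1 tmin] := EVT_min_rV S0 cS (continuous_subspaceT cW).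
rewrite inE in t1; exists t => //; apply: le_anti.
rewrite min_width_le// andbT; apply: lb_le_inf; first by exists (width Gamma t), t.
by move=> _ [s s1 <-]; apply: tmin; rewrite inE.
Qed.

(* The boundary is swept from a point [c t0] extremal in the direction
   orthogonal to [theta]; the two endpoints are kept, up to [eta], on a common
   line parallel to [theta], hence at distance at most the width of the strip
   up to [eta]. The tilt [eta x / L] makes the two monotone arcs strictly
   monotone, so that they can be matched even along segments parallel to
   [theta]. *)
Lemma narrow_sweepout (theta : plane) (lo hi eta : R) : enorm theta = 1 ->
  (forall x, Gamma x -> lo <= dotp x theta <= hi) -> 0 < eta ->
  exists p q C, is_sweepout Gamma p q C /\
    exists M, is_max [set enorm (p t - q t) | t in [set t : R | 0 <= t <= 1]] M /\
      M <= hi - lo + eta.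
Proof.
move=> theta1 strip eta0.
have [z Iz] := Omega_domain.
have [rho rhoP] := radial_function_exists Omega_compact Iz.
have u1 : enorm (perp theta) = 1 by rewrite enorm_perp.
pose c := radial_curve z rho (perp theta).
pose X := abscissa rho (perp theta).
have cJ : jordan_parametrization Gamma c.
  exact: (radial_curve_jordan Omega_compact Omega_convex Iz rhoP u1).
have [K K0 cK] : exists2 K : R, 0 < K &
    forall s t, enorm (c s - c t) <= K * `|s - t|.
  exact: (radial_curve_lipschitz Omega_compact Omega_convex Iz rhoP u1).
have cX : continuous X.
  exact: (abscissa_continuous Omega_compact Omega_convex Iz rhoP u1).
have XE t : dotp (c t) (perp theta) = dotp z (perp theta) + X t.
  exact: (dotp_radial_curve z rho u1 t).
have X1 t : X (t + 1) = X t by exact: (abscissa_int rho (perp theta) t 1).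
have [t0 [t1 [/andP[t01 t10] Xdec Xinc]]] :=
  abscissa_bimonotone Omega_compact Omega_convex Iz rhoP u1.
rewrite -/X in Xdec Xinc.
clearbody c X.
pose L1 := t1 - t0; pose L2 := 1 - L1.
have L1p : 0 < L1 by rewrite /L1; lra.
have L2p : 0 < L2 by rewrite /L2 /L1; lra.
(* Dividing by [L1] and [L2] makes both tilts run from 0 to [eta]: the end values still agree, and
   matched points have abscissae differing by at most [eta]. *)
pose g1 x := X (t0 + x) - eta * (x / L1).
pose g2 x := X (t0 - x) - eta * (x / L2).
have ctilt (L : R) : continuous (fun x : R => eta * (x / L)).
  by move=> x; apply: cvgMl_tmp; apply: cvgMr_tmp; exact: cvg_id.
have cg1 : continuous g1.
  move=> x; apply: cvgB; last exact: ctilt.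
  apply: (continuous_comp (f := fun x => t0 + x)); last exact: cX.
  by apply: cvgD; [exact: cvg_cst|exact: cvg_id].
have cg2 : continuous g2.
  move=> x; apply: cvgB; last exact: ctilt.
  apply: (continuous_comp (f := fun x => t0 - x)); last exact: cX.
  by apply: cvgB; [exact: cvg_cst|exact: cvg_id].
have tilt_lt (L s t : R) : 0 < L -> s < t -> eta * (s / L) < eta * (t / L).
  by move=> L0 st; rewrite ltr_pM2l// ltr_pM2r ?invr_gt0.
have g1d s t : 0 <= s -> s < t -> t <= L1 -> g1 t < g1 s.
  rewrite /L1 => s0 st tL; have := tilt_lt _ _ _ L1p st.
  by have := Xdec (t0 + s) (t0 + t) ltac:(lra) ltac:(lra) ltac:(lra); rewrite /g1; lra.
have g2d s t : 0 <= s -> s < t -> t <= L2 -> g2 t < g2 s.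
  rewrite /L2 /L1 => s0 st tL; have := tilt_lt _ _ _ L2p st.
  by have := Xinc (t0 - t) (t0 - s) ltac:(lra) ltac:(lra) ltac:(lra); rewrite /g2; lra.
have g_start : g1 0 = g2 0 by rewrite /g1 /g2 !mul0r !mulr0 addr0 !subr0.
have g_end : g1 L1 = g2 L2.
  rewrite /g1 /g2 !divff ?gt_eqF// -(X1 (t0 - L2)); congr (X _ - _).
  by rewrite /L2 /L1; ring.
have L12 : L1 + L2 = 1 by rewrite /L2; ring.
have [a [b [ab mono]]] := decreasing_matching cg1 cg2 (ltW L1p) (ltW L2p)
  g1d g2d g_start g_end.
rewrite L12 in ab mono.
(* Both functions are nondecreasing and their sum is the identity. *)
have a_lip s t : 0 <= s <= 1 -> 0 <= t <= 1 -> `|a s - a t| <= `|s - t| /\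
    `|b s - b t| <= `|s - t|.
  move=> hs ht; wlog st : s t hs ht / s <= t.
    move=> h; have [st|ts] := leP s t; first exact: h.
    by rewrite (distrC (a s)) (distrC (b s)) (distrC s); apply: h => //; exact: ltW.
  have /andP[s0 _] := hs; have /andP[_ t1'] := ht.
  have [m1 m2] := mono s t s0 st t1'.
  have [_ _ es _] := ab _ hs; have [_ _ et _] := ab _ ht.
  rewrite (distrC (a s)) (distrC (b s)) (distrC s) !ger0_norm ?subr_ge0//.
  by split; lra.
have h0 : 0 <= (0 : R) <= 1 by rewrite lexx ler01.
have h1 : 0 <= (1 : R) <= 1 by rewrite lexx ler01.
have [/andP[a00 _] /andP[b00 _] ab0 _] := ab _ h0.
have [/andP[_ a1L] /andP[_ b1L] ab1 _] := ab _ h1.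
have a0 : a 0 = 0 by lra.
have b0 : b 0 = 0 by lra.
have a1 : a 1 = L1 by lra.
have b1 : b 1 = L2 by lra.
pose p t := c (t0 - b t); pose q t := c (t0 + a t).
pose C t := c @` `[t0 - b t, t0 + a t].
have p_lip s t : 0 <= s <= 1 -> 0 <= t <= 1 -> enorm (p s - p t) <= K * `|s - t|.
  move=> hs ht; apply: le_trans (cK _ _) _; rewrite ler_pM2l//.
  rewrite (_ : _ - _ = - (b s - b t)) ?normrN; last ring.
  by have [] := a_lip s t hs ht.
have q_lip s t : 0 <= s <= 1 -> 0 <= t <= 1 -> enorm (q s - q t) <= K * `|s - t|.
  move=> hs ht; apply: le_trans (cK _ _) _; rewrite ler_pM2l//.
  rewrite (_ : _ - _ = a s - a t); last ring.
  by have [] := a_lip s t hs ht.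
have pq1 : p 1 = q 1.
  rewrite /p /q a1 b1 -(jordan_period1 cJ); congr c; rewrite /L2; ring.
have itv01 (t : R) : `[0, 1]%classic t -> 0 <= t <= 1 by rewrite /= in_itv.
have within_lip (f : R -> plane) : (forall s t, 0 <= s <= 1 -> 0 <= t <= 1 ->
    enorm (f s - f t) <= K * `|s - t|) -> {within `[0, 1], continuous f}.
  move=> hf; apply: (@lipschitz_within_continuous _ _ _ K) => s t /itv01 hs /itv01 ht.
  exact: le_trans (normr_le_enorm _) (hf s t hs ht).
(* For [s <= t] the arcs are nested, and the two added pieces have parameter lengths [b t - b s] and
   [a t - a s], of sum [t - s]. *)
have lenC s t : 0 <= s <= 1 -> 0 <= t <= 1 ->
    (length (C s `+` C t) <= (K * `|s - t|)%:E)%E.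
  move=> hs ht; wlog st : s t hs ht / s <= t.
    move=> h; have [st|ts] := leP s t; first exact: h.
    by rewrite setYC distrC; apply: h => //; exact: ltW.
  have /andP[s0 _] := hs; have /andP[_ t1'] := ht.
  have [m1 m2] := mono s t s0 st t1'.
  have [/andP[as0 _] /andP[bs0 _] es _] := ab _ hs; have [_ _ et _] := ab _ ht.
  apply: finely_covered_length.
  have -> : K * `|s - t| = K * ((t0 - b s) - (t0 - b t)) +
                           K * ((t0 + a t) - (t0 + a s)).
    by rewrite -mulrDr; congr (K * _); rewrite distrC ger0_norm ?subr_ge0//; lra.
  apply: finely_covered_sub (finely_coveredU (arc_finely_covered (ltW K0) cK _)
    (arc_finely_covered (ltW K0) cK _)); [|lra|lra].
  move=> x [[[r + <-] nC]|[[r + <-] nC]]; rewrite /= in_itv/= => /andP[r1 r2].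
    by exfalso; apply: nC; exists r => //=; rewrite in_itv/=; apply/andP; split; lra.
  have [rb|rb] := leP r (t0 - b s).
    by left; exists r => //=; rewrite in_itv/= r1.
  have [ra|ra] := leP r (t0 + a s).
    by exfalso; apply: nC; exists r => //=; rewrite in_itv/= ra (ltW rb).
  by right; exists r => //=; rewrite in_itv/= r2 (ltW ra).
exists p, q, C; split.
  split.
  - by move=> t _; split; exact: (jordan_mem cJ).
  - by split=> //; rewrite /p /q a0 b0 subr0 addr0.
  - by split; exact: within_lip.
  - split=> t ht.
      have [/andP[at0 _] /andP[bt0 _] et _] := ab _ ht.
      exists c, (t0 - b t), (t0 + a t); split=> //.
      by move/andP: ht => [_ ht]; apply/andP; split; lra.
    apply: (@squeeze_cvge _ _ _ _ (cst 0%E) _ (fun s => (K * `|s - t|)%:E)).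
    + near=> s; rewrite length_ge0 lenC//.
      by apply: itv01; near: s; exact: withinT.
    + exact: cvg_cst.
    + apply: cvg_EFin; first by near=> s.
      have cdist : continuous (fun s : R => K * `|s - t|).
        apply: (@dist_lipschitz_continuous R R^o R^o _ K) => r s.
        rewrite -mulrBr normrM gtr0_norm// ler_pM2l//.
        by apply: le_trans (ler_dist_dist _ _) _; rewrite opprB addrA subrK.
      apply: (@cvg_within_filter _ _ (fun s => K * `|s - t|)).
      by have := cdist t; rewrite /continuous_at subrr normr0 mulr0.
  - split.
      rewrite /C /p a0 b0 subr0 addr0 set_itv1 image_set1 //.
    rewrite /C a1 b1; apply/seteqP; split=> [_ [r _ <-]|x Gx].
      exact: (jordan_mem cJ).
    have [r /andP[r1 r2] rx] := jordan_lift cJ (t0 - L2) Gx.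
    by exists r => //=; rewrite in_itv/=; apply/andP; split; rewrite /L2 in r1 r2 *; lra.
have pq_cont : {within `[0, 1], continuous (fun t => enorm (p t - q t))}.
  apply: (@lipschitz_within_continuous R R^o _ (K + K)) => s t /itv01 hs /itv01 ht.
  apply: le_trans (ler_dist_enorm _ _) _.
  have -> : p s - q s - (p t - q t) = (p s - p t) - (q s - q t).
    by rewrite opprB (addrC (q t)) addrACA opprB (addrC (q t)).
  apply: le_trans (ler_enormD _ _) _; rewrite enormN mulrDl.
  by apply: lerD; [exact: p_lip|exact: q_lip].
have [m + mmax] := EVT_max (@ler01 R) pq_cont.
rewrite in_itv/= => m01; exists (enorm (p m - q m)); split.
  split; first by exists m.
  by move=> _ [t ht <-]; apply: mmax; rewrite in_itv.
have [/andP[am0 amL] /andP[bm0 bmL] _ gm] := ab _ m01.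
have /strip/andP[p1 p2] : Gamma (p m) by exact: (jordan_mem cJ).
have /strip/andP[q1 q2] : Gamma (q m) by exact: (jordan_mem cJ).
have sg : 0 <= hi - lo by lra.
have along : `|dotp (p m - q m) theta| <= hi - lo.
  by rewrite dotpBl ler_norml; apply/andP; split; lra.
have across : `|dotp (p m - q m) (perp theta)| <= eta.
  rewrite dotpBl !XE.
  have ra0 : 0 <= a m / L1 by rewrite divr_ge0// ltW.
  have ra1 : a m / L1 <= 1 by rewrite ler_pdivrMr// mul1r.
  have rb0 : 0 <= b m / L2 by rewrite divr_ge0// ltW.
  have rb1 : b m / L2 <= 1 by rewrite ler_pdivrMr// mul1r.
  have ea : 0 <= eta * (a m / L1) by rewrite mulr_ge0// ltW.
  have ea1 : eta * (a m / L1) <= eta by rewrite ger_pMr.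
  have eb : 0 <= eta * (b m / L2) by rewrite mulr_ge0// ltW.
  have eb1 : eta * (b m / L2) <= eta by rewrite ger_pMr.
  by move: gm; rewrite /g1 /g2 ler_norml => gm; apply/andP; split; lra.
rewrite -(@ler_pXn2r _ 2)// ?nnegrE ?enorm_ge0//; last lra.
have := dotp_pythagoras theta (p m - q m).
rewrite -!enorm_sqr theta1 expr1n mul1r => ->.
have s1 : dotp (p m - q m) theta ^+ 2 <= (hi - lo) ^+ 2.
  by rewrite -real_normK ?num_real// ler_pXn2r// nnegrE.
have s2 : dotp (p m - q m) (perp theta) ^+ 2 <= eta ^+ 2.
  by rewrite -real_normK ?num_real// ler_pXn2r// nnegrE ltW.
have := mulr_ge0 sg (ltW eta0); rewrite sqrrD; lra.
Unshelve. all: by end_near. Qed.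

End Upper.

Theorem corollary1p4 (R : realType) (Omega : set 'rV[R]_2)
    (Omega_compact : compact Omega) (Omega_convex : convex_set Omega)
    (Omega_domain : interior Omega !=set0)
    (Omega_smooth : smooth_boundary Omega) :
  minmax_width (boundary Omega) = (min_width (boundary Omega))%:E /\
  is_min [set width (boundary Omega) theta | theta in unit_circle R]
    (min_width (boundary Omega)).
Proof.
have [theta theta1 wE] := width_min_attained Omega_compact Omega_domain.
have [M M0 hM] := convex_body_bounded Omega_compact.
have GM x : boundary Omega x -> enorm x <= M.
  by move=> Gx; apply: hM; exact: (boundary_sub Omega_compact).
have G0 := boundary_nonempty Omega_compact Omega_domain.
split; last first.
  split; first by exists theta.
  by move=> _ [t t1 <-]; exact: min_width_le.
apply/eqP; rewrite eq_le; apply/andP; split.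
  apply/lee_addgt0Pr => e e0.
  (* One half of [e] for a strip nearly realising the width, the other for the tilt. *)
  have e2 : 0 < e / 2 by rewrite divr_gt0.
  have [lo [hi [strip hlo]]] := strip_of_width G0 GM theta e2.
  have [p [q [C [sw [m [mmax mle]]]]]] :=
    narrow_sweepout Omega_compact Omega_convex Omega_domain theta1 strip e2.
  apply: (@le_trans _ _ m%:E).
    by apply: ereal_inf_lbound; exists m => //; exists p, q, C.
  by rewrite -EFinD lee_fin; move: hlo; rewrite wE; lra.
apply: le_ereal_inf_tmp => _ [m [p [q [C [sw [_ mub]]]]] <-].
have [t t01 wt] := sweepout_wide Omega_compact Omega_convex Omega_domain sw.
by rewrite lee_fin (le_trans wt)// mub//; exists t.
Qed.
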